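(* Given a collection $x:\mathcal{X}\to\mathcal{T}(\mathbf{1})$, the collection $Taut(\mathcal{X}):[\mathcal{X},\mathcal{X}]\to\mathcal{T}(\mathbf{1})$ admits the structure of a globular operad.
   Context: The globe category $\mathbb{G}$ has object set $\mathbb{N}$ and morphisms generated by $\sigma_n,\tau_n:n\to n+1$ subject to $\sigma_{n+1}\circ\sigma_n=\tau_{n+1}\circ\sigma_n$ and $\sigma_{n+1}\circ\tau_n=\tau_{n+1}\circ\tau_n$. A globular set is a contravariant functor $\mathbb{G}\to\mathbf{Set}$, and $\mathbf{Glob}$ is the category of globular sets and natural transformations. Let $\mathbf{1}$ be the terminal globular set (one cell in each dimension). Let $(\mathcal{T},\mu,\eta)$ be the free strict $\omega$-category monad on $\mathbf{Glob}$: $\mathcal{T}(\mathcal{X})$ is the underlying globular set of the free strict $\omega$-category on $\mathcal{X}$. It is a cartesian monad ($\mathcal{T}$ preserves pullbacks and all naturality squares of $\mu$ and $\eta$ are pullbacks). A collection is a globular set $\mathcal{X}$ with a globular set map $x:\mathcal{X}\to\mathcal{T}(\mathbf{1})$ (the arity map). Collection homomorphisms are globular set maps over $\mathcal{T}(\mathbf{1})$, so the category of collections is $\mathbf{Col}=\mathbf{Glob}/\mathcal{T}(\mathbf{1})$. For collections $x:\mathcal{X}\to\mathcal{T}(\mathbf{1})$ and $y:\mathcal{Y}\to\mathcal{T}(\mathbf{1})$, the composition tensor product $\mathcal{X}\,\square\,\mathcal{Y}$ is the pullback of $x$ and $\mathcal{T}(!_{\mathcal{Y}}):\mathcal{T}(\mathcal{Y})\to\mathcal{T}(\mathbf{1})$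 (with $!_{\mathcal{Y}}:\mathcal{Y}\to\mathbf{1}$), with projections $\pi_1,\pi_2$ to $\mathcal{X}$ and $\mathcal{T}(\mathcal{Y})$. Its arity map is $x\,\square\,y=\mu_{\mathbf{1}}\circ\mathcal{T}(y)\circ\pi_2$. $(\mathbf{Col},\square,\mathbf{1})$ is a monoidal category. Its unit is $I=\eta_{\mathbf{1}}:\mathbf{1}\hookrightarrow\mathcal{T}(\mathbf{1})$ (inclusion of generators). Its associator $\alpha:\mathcal{X}\,\square\,(\mathcal{Y}\,\square\,\mathcal{Z})\to(\mathcal{X}\,\square\,\mathcal{Y})\,\square\,\mathcal{Z}$ is the map determined by $\pi_1\circ\alpha=(\pi_1,\mathcal{T}(\pi_1)\circ\pi_2)$ and $\pi_2\circ\alpha=\mu_{\mathcal{Z}}\circ\mathcal{T}(\pi_2)\circ\pi_2$. The left unitor $\lambda_{\mathcal{X}}:\mathbf{1}\,\square\,\mathcal{X}\to\mathcal{X}$ is determined by $\eta_{\mathcal{X}}\circ\lambda_{\mathcal{X}}=\pi_2$, and the right unitor $\mathcal{X}\,\square\,\mathbf{1}\to\mathcal{X}$ is $\pi_1$. A globular operad is a monoid object in $(\mathbf{Col},\square,\mathbf{1})$. For a collection $b:\mathcal{B}\to\mathcal{T}(\mathbf{1})$, the internal hom functor $[\mathcal{B},-]:\mathbf{Col}\to\mathbf{Col}$ is the right adjoint of $-\,\square\,\mathcal{B}$. It is given by $[\mathcal{B},-]=\Pi_{\mathcal{T}(!_{\mathcal{B}})}\,\mathcal{T}(b)^*\,\mu_{\mathbf{1}}^*$,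 where for a globular set map $\phi$, $\phi^*$ is pullback along $\phi$ between slice categories of $\mathbf{Glob}$ and $\Pi_\phi$ is the right adjoint of $\phi^*$. The collection $Taut(\mathcal{X})$ is defined to be $[\mathcal{X},\mathcal{X}]$ with its arity map to $\mathcal{T}(\mathbf{1})$. *)

(* Defs.v *)
From mathcomp Require Import all_boot.
From Stdlib Require Import FunctionalExtensionality PropExtensionality.
From Stdlib Require Import ProofIrrelevance ClassicalEpsilon.

Set Implicit Arguments.
Unset Strict Implicit.
Unset Printing Implicit Defensive.

(* A functor G^op -> Set, given by its values on the generators sigma_n and
   tau_n (src and tgt) subject to the images of the defining relations of the
   globe category.                                                          *)
Record globset := GlobSet {
  cell :> nat -> Type;
  src : forall n, cell n.+1 -> cell n;
  tgt : forall n, cell n.+1 -> cell n;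
  src_glob : forall n (x : cell n.+2), src (src x) = src (tgt x);
  tgt_glob : forall n (x : cell n.+2), tgt (src x) = tgt (tgt x) }.

Arguments src {g n} _.
Arguments tgt {g n} _.

Record gmap (A B : globset) := GMap {
  gfun :> forall n, A n -> B n;
  gfun_src : forall n (x : A n.+1), gfun (src x) = src (gfun x);
  gfun_tgt : forall n (x : A n.+1), gfun (tgt x) = tgt (gfun x) }.

Arguments gfun {A B} _ n _.

Lemma gmap_ext (A B : globset) (f g : gmap A B) :
  (forall n (x : A n), f n x = g n x) -> f = g.
Proof.
case: f g => [f fs ft] [g gs gt] /= fg.
have E : f = g.
  by apply: functional_extensionality_dep => n; apply: functional_extensionality.
by subst g; rewrite (proof_irrelevance _ fs gs) (proof_irrelevance _ ft gt).
Qed.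

Definition gid (A : globset) : gmap A A :=
  @GMap A A (fun _ x => x) (fun _ _ => erefl) (fun _ _ => erefl).

Lemma gcomp_src (A B C : globset) (g : gmap B C) (f : gmap A B) n (x : A n.+1) :
  g n (f n (src x)) = src (g _ (f _ x)).
Proof. by rewrite !gfun_src. Qed.

Lemma gcomp_tgt (A B C : globset) (g : gmap B C) (f : gmap A B) n (x : A n.+1) :
  g n (f n (tgt x)) = tgt (g _ (f _ x)).
Proof. by rewrite !gfun_tgt. Qed.

Definition gcomp (A B C : globset) (g : gmap B C) (f : gmap A B) : gmap A C :=
  @GMap A C (fun n x => g n (f n x)) (gcomp_src g f) (gcomp_tgt g f).

Notation "g \og f" := (gcomp g f) (at level 50, left associativity).

Definition terminal : globset :=
  @GlobSet (fun _ => unit) (fun _ _ => tt) (fun _ _ => tt)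
    (fun _ _ => erefl) (fun _ _ => erefl).

Definition bang (A : globset) : gmap A terminal :=
  @GMap A terminal (fun _ _ => tt) (fun _ _ => erefl) (fun _ _ => erefl).

Section Pullback.
Context (A B C : globset) (f : gmap A C) (g : gmap B C).

Definition pb_cell (n : nat) : Type := {p : A n * B n | f n p.1 = g n p.2}.

Lemma pb_src_subproof n (p : pb_cell n.+1) :
  f n (src (sval p).1) = g n (src (sval p).2).
Proof. by rewrite !gfun_src (svalP p). Qed.

Lemma pb_tgt_subproof n (p : pb_cell n.+1) :
  f n (tgt (sval p).1) = g n (tgt (sval p).2).
Proof. by rewrite !gfun_tgt (svalP p). Qed.

Definition pb_src n (p : pb_cell n.+1) : pb_cell n :=
  exist _ (src (sval p).1, src (sval p).2) (pb_src_subproof p).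

Definition pb_tgt n (p : pb_cell n.+1) : pb_cell n :=
  exist _ (tgt (sval p).1, tgt (sval p).2) (pb_tgt_subproof p).

Lemma pb_cell_ext n (p q : pb_cell n) :
  (sval p).1 = (sval q).1 -> (sval p).2 = (sval q).2 -> p = q.
Proof.
case: p q => [[a b] pP] [[a' b'] qP] /= Ea Eb; subst a' b'.
by rewrite (proof_irrelevance _ pP qP).
Qed.

Lemma pb_src_glob n (p : pb_cell n.+2) : pb_src (pb_src p) = pb_src (pb_tgt p).
Proof. by apply: pb_cell_ext; apply: src_glob. Qed.

Lemma pb_tgt_glob n (p : pb_cell n.+2) : pb_tgt (pb_src p) = pb_tgt (pb_tgt p).
Proof. by apply: pb_cell_ext; apply: tgt_glob. Qed.

Definition pullback : globset := @GlobSet pb_cell pb_src pb_tgt pb_src_glob pb_tgt_glob.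

Definition pb_fst : gmap pullback A :=
  @GMap pullback A (fun n p => (sval p).1) (fun _ _ => erefl) (fun _ _ => erefl).

Definition pb_snd : gmap pullback B :=
  @GMap pullback B (fun n p => (sval p).2) (fun _ _ => erefl) (fun _ _ => erefl).

Lemma pb_square : f \og pb_fst = g \og pb_snd.
Proof. by apply: gmap_ext => n p; apply: (svalP p). Qed.

Section Pair.
Context (Z : globset) (u : gmap Z A) (v : gmap Z B).
Context (uv : f \og u = g \og v).

Definition pb_pair_fun n (z : Z n) : pullback n :=
  exist _ (u n z, v n z) (f_equal (fun h : gmap Z C => h n z) uv).

Lemma pb_pair_src n (z : Z n.+1) : pb_pair_fun (src z) = src (pb_pair_fun z).
Proof. by apply: pb_cell_ext; apply: gfun_src. Qed.

Lemma pb_pair_tgt n (z : Z n.+1) : pb_pair_fun (tgt z) = tgt (pb_pair_fun z).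
Proof. by apply: pb_cell_ext; apply: gfun_tgt. Qed.

Definition pb_pair : gmap Z pullback := @GMap Z pullback pb_pair_fun pb_pair_src pb_pair_tgt.

End Pair.
End Pullback.

Record slice (Z : globset) := Slice { dom :> globset; proj : gmap dom Z }.

Arguments proj {Z} _.

Record slice_hom (Z : globset) (S R : slice Z) := SliceHom {
  shmap :> gmap S R;
  shcomm : proj R \og shmap = proj S }.

Lemma slice_hom_ext Z (S R : slice Z) (f g : slice_hom S R) :
  (f : gmap S R) = g -> f = g.
Proof.
case: f g => [f fP] [g gP] /= E; subst g.
by rewrite (proof_irrelevance _ fP gP).
Qed.

Lemma slice_homP Z (S R : slice Z) (f : slice_hom S R) n (x : S n) :
  proj R n (f n x) = proj S n x.
Proof. by rewrite -(shcomm f). Qed.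

Lemma slice_id_subproof Z (S : slice Z) : proj S \og gid S = proj S.
Proof. exact: gmap_ext. Qed.

Definition slice_id Z (S : slice Z) : slice_hom S S :=
  @SliceHom Z S S (gid S) (slice_id_subproof S).

Lemma slice_comp_subproof Z (S R Q : slice Z) (g : slice_hom R Q)
  (f : slice_hom S R) : proj Q \og (g \og f) = proj S.
Proof. by rewrite -(shcomm f) -(shcomm g); apply: gmap_ext. Qed.

Definition slice_comp Z (S R Q : slice Z) (g : slice_hom R Q)
  (f : slice_hom S R) : slice_hom S Q :=
  @SliceHom Z S Q (g \og f) (slice_comp_subproof g f).

Notation "g \os f" := (slice_comp g f) (at level 50, left associativity).

Section PullbackFunctor.
Context (A B : globset) (phi : gmap A B).

Definition pbf (S : slice B) : slice A := Slice (pb_snd (proj S) phi).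

Lemma pbf_map_subproof (S R : slice B) (f : slice_hom S R) :
  proj R \og (f \og pb_fst (proj S) phi) = phi \og pb_snd (proj S) phi.
Proof. by rewrite -pb_square -(shcomm f); apply: gmap_ext. Qed.

Lemma pbf_map_comm (S R : slice B) (f : slice_hom S R) :
  proj (pbf R) \og pb_pair (pbf_map_subproof f) = proj (pbf S).
Proof. exact: gmap_ext. Qed.

Definition pbf_map (S R : slice B) (f : slice_hom S R) :
  slice_hom (pbf S) (pbf R) :=
  @SliceHom A (pbf S) (pbf R) (pb_pair (pbf_map_subproof f)) (pbf_map_comm f).

End PullbackFunctor.

(* k < n as a datum in Type, so that one can recurse on it; each lt_dim k n
   has at most one inhabitant.                                              *)
Inductive lt_dim (k : nat) : nat -> Type :=
  | ltd_S : lt_dim k k.+1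
  | ltd_up n of lt_dim k n : lt_dim k n.+1.

Arguments ltd_S {k}.
Arguments ltd_up {k n} _.

Section IteratedBoundary.
Context (X : globset).

Fixpoint isrc k n (p : lt_dim k n) : X n -> X k :=
  match p in lt_dim _ m return X m -> X k with
  | ltd_S => fun x => src x
  | ltd_up _ q => fun x => isrc q (src x)
  end.

Fixpoint itgt k n (p : lt_dim k n) : X n -> X k :=
  match p in lt_dim _ m return X m -> X k with
  | ltd_S => fun x => tgt x
  | ltd_up _ q => fun x => itgt q (tgt x)
  end.

End IteratedBoundary.

Lemma ltd_ltn k n (p : lt_dim k n) : k < n.
Proof. by elim: p => // m _; apply: ltnW. Qed.

Lemma lt_dim_irr k n (p q : lt_dim k n) : p = q.
Proof.
have inv m (r : lt_dim k m) : match m return lt_dim k m -> Prop with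
    | 0 => fun _ => False
    | m'.+1 => fun r =>
        (exists e : k = m', r = eq_rect k (fun i => lt_dim k i.+1) ltd_S m' e)
        \/ exists r', r = ltd_up r'
    end r.
  by case: r => [|m' r']; [left; exists erefl | right; exists r'].
elim: p q => [|m p IH] q; case: (inv _ q) => [[e ->]|[q' ->]].
- by rewrite (proof_irrelevance _ e erefl).
- by have := ltd_ltn q'; rewrite ltnn.
- by exfalso; have := ltd_ltn p; rewrite -e ltnn.
- by rewrite (IH q').
Qed.

Fixpoint ltd_pred k n (p : lt_dim k.+1 n) : lt_dim k n :=
  match p in lt_dim _ m return lt_dim k m with
  | ltd_S => ltd_up ltd_S
  | ltd_up _ q => ltd_up (ltd_pred q)
  end.

Lemma isrc_glob (X : globset) k n (p : lt_dim k n) (x : X n.+1) :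
  isrc p (tgt x) = isrc p (src x).
Proof. by case: p x => [|m q] x /=; rewrite src_glob. Qed.

Lemma itgt_glob (X : globset) k n (p : lt_dim k n) (x : X n.+1) :
  itgt p (src x) = itgt p (tgt x).
Proof. by case: p x => [|m q] x /=; rewrite tgt_glob. Qed.

Lemma src_isrc (X : globset) k n (p : lt_dim k.+1 n) (x : X n) :
  src (isrc p x) = isrc (ltd_pred p) x.
Proof. by elim: p x => [|m q IH] x //=; rewrite IH. Qed.

Lemma src_itgt (X : globset) k n (p : lt_dim k.+1 n) (x : X n) :
  src (itgt p x) = isrc (ltd_pred p) x.
Proof.
elim: p x => [|m q IH] x /=; first by rewrite src_glob.
by rewrite IH isrc_glob.
Qed.

Lemma tgt_itgt (X : globset) k n (p : lt_dim k.+1 n) (x : X n) :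
  tgt (itgt p x) = itgt (ltd_pred p) x.
Proof. by elim: p x => [|m q IH] x //=; rewrite IH. Qed.

Lemma tgt_isrc (X : globset) k n (p : lt_dim k.+1 n) (x : X n) :
  tgt (isrc p x) = itgt (ltd_pred p) x.
Proof.
elim: p x => [|m q IH] x /=; first by rewrite tgt_glob.
by rewrite IH itgt_glob.
Qed.

Lemma gfun_isrc (A B : globset) (f : gmap A B) k n (p : lt_dim k n) (x : A n) :
  f k (isrc p x) = isrc p (f n x).
Proof. by elim: p x => [|m q IH] x /=; rewrite ?IH gfun_src. Qed.

Lemma gfun_itgt (A B : globset) (f : gmap A B) k n (p : lt_dim k n) (x : A n) :
  f k (itgt p x) = itgt p (f n x).
Proof. by elim: p x => [|m q IH] x /=; rewrite ?IH gfun_tgt. Qed.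

(* The representable G(-, n): a morphism k -> n of the globe category is the
   identity, or else k < n and it is determined by its first generator, sigma
   (false, i.e. iterated source) or tau (true, i.e. iterated target).       *)
Inductive globe_cell (n : nat) : nat -> Type :=
  | gc_top : globe_cell n n
  | gc_bd k of lt_dim k n & bool : globe_cell n k.

Arguments gc_top {n}.
Arguments gc_bd {n k} _ _.

Definition globe_bd (b : bool) n k (c : globe_cell n k.+1) : globe_cell n k :=
  match c in globe_cell _ m
    return match m with 0 => unit | k.+1 => globe_cell n k end with
  | gc_top => match n with 0 => tt | n'.+1 => gc_bd ltd_S b end
  | gc_bd m p _ =>
      match m return lt_dim m n ->
        match m with 0 => unit | k.+1 => globe_cell n k end with
      | 0 => fun _ => tt
      | _.+1 => fun p => gc_bd (ltd_pred p) b
      end p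
  end.

Lemma globe_cellS_ind (Q : forall n k, globe_cell n k.+1 -> Prop) :
  (forall k, Q k.+1 k gc_top) ->
  (forall n k p b, Q n k (gc_bd p b)) ->
  forall n k (c : globe_cell n k.+1), Q n k c.
Proof.
move=> Qtop Qbd n k c.
pose R m := match m return globe_cell n m -> Prop with
  | 0 => fun _ => True
  | m'.+1 => fun c => Q n m' c end.
suff: R k.+1 c by [].
case: c => [|m p a]; last by case: m p => [|m] p //=; apply: Qbd.
by case: n @R => [|m] //=; apply: Qtop.
Qed.

Lemma globe_bd_bd b n k (c : globe_cell n k.+2) :
  globe_bd b (globe_bd false c) = globe_bd b (globe_bd true c).
Proof.
pose Q n k := match k return globe_cell n k.+1 -> Prop with
  | 0 => fun _ => True
  | k'.+1 => fun c => globe_bd b (globe_bd false c) = globe_bd b (globe_bd true c)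
  end.
by apply: (@globe_cellS_ind Q _ _ n k.+1 c) => [[]|? []].
Qed.

Definition globe (n : nat) : globset :=
  @GlobSet (globe_cell n) (@globe_bd false n) (@globe_bd true n)
    (@globe_bd_bd false n) (@globe_bd_bd true n).

(* The map globe n -> X classifying an n-cell of X (Yoneda).                *)
Definition yon_fun (X : globset) n (x : X n) k (c : globe n k) : X k :=
  match c in globe_cell _ m return X m with
  | gc_top => x
  | gc_bd _ p b => if b then itgt p x else isrc p x
  end.

Lemma yon_src (X : globset) n (x : X n) k (c : globe n k.+1) :
  yon_fun x (src c) = src (yon_fun x c).
Proof.
pose Q n k (c : globe_cell n k.+1) := forall x : X n,
  yon_fun x (globe_bd false c : globe n k) = src (yon_fun x (c : globe n k.+1)).
apply: (@globe_cellS_ind Q _ _ n k c) => [//|m j p [] {}x /=].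
  by rewrite src_itgt.
by rewrite src_isrc.
Qed.

Lemma yon_tgt (X : globset) n (x : X n) k (c : globe n k.+1) :
  yon_fun x (tgt c) = tgt (yon_fun x c).
Proof.
pose Q n k (c : globe_cell n k.+1) := forall x : X n,
  yon_fun x (globe_bd true c : globe n k) = tgt (yon_fun x (c : globe n k.+1)).
apply: (@globe_cellS_ind Q _ _ n k c) => [//|m j p [] {}x /=].
  by rewrite tgt_itgt.
by rewrite tgt_isrc.
Qed.

Definition yon (X : globset) n (x : X n) : gmap (globe n) X :=
  @GMap (globe n) X (yon_fun x) (yon_src x) (yon_tgt x).

Lemma gfun_yon (A B : globset) (f : gmap A B) n (x : A n) k (c : globe n k) :
  f k (yon x k c) = yon (f n x) k c.
Proof. by case: c => [|m p []] //=; rewrite ?gfun_itgt ?gfun_isrc. Qed.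

Definition coface (b : bool) n : gmap (globe n) (globe n.+1) :=
  yon (gc_bd ltd_S b : globe n.+1 n).

Section DependentProduct.
Context (A B : globset) (phi : gmap A B) (E : slice A).

Definition globe_over n (b : B n) : slice B := Slice (yon b).

Lemma coface_src_subproof n (b : B n.+1) :
  proj (globe_over b) \og coface false n = proj (globe_over (src b)).
Proof. by apply: gmap_ext => k c; apply: (gfun_yon (yon b)). Qed.

Lemma coface_tgt_subproof n (b : B n.+1) :
  proj (globe_over b) \og coface true n = proj (globe_over (tgt b)).
Proof. by apply: gmap_ext => k c; apply: (gfun_yon (yon b)). Qed.

Definition coface_src n (b : B n.+1) :
  slice_hom (globe_over (src b)) (globe_over b) :=
  @SliceHom B (globe_over (src b)) (globe_over b) (coface false n)
    (coface_src_subproof b).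

Definition coface_tgt n (b : B n.+1) :
  slice_hom (globe_over (tgt b)) (globe_over b) :=
  @SliceHom B (globe_over (tgt b)) (globe_over b) (coface true n)
    (coface_tgt_subproof b).

(* By Yoneda, an n-cell over b of the right adjoint must be a map
   phi^*(globe n, b) -> E over A.                                           *)
Definition Pi_cell n : Type :=
  {b : B n & slice_hom (pbf phi (globe_over b)) E}.

Definition Pi_src n (s : Pi_cell n.+1) : Pi_cell n :=
  existT _ (src (projT1 s)) (projT2 s \os pbf_map phi (coface_src (projT1 s))).

Definition Pi_tgt n (s : Pi_cell n.+1) : Pi_cell n :=
  existT _ (tgt (projT1 s)) (projT2 s \os pbf_map phi (coface_tgt (projT1 s))).

Lemma Pi_cell_ext n (s s' : Pi_cell n) :
  projT1 s = projT1 s' ->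
  (forall k (c : globe n k) (a : A k) H H',
     projT2 s k (exist _ (c, a) H) = projT2 s' k (exist _ (c, a) H')) ->
  s = s'.
Proof.
case: s s' => [b h] [b' h'] /= Eb; subst b' => Eh.
by congr existT; apply: slice_hom_ext; apply: gmap_ext => k [[c a] H]; apply: Eh.
Qed.

Lemma coface_glob b n k (c : globe n k) :
  coface false n.+1 k (coface b n k c) = coface true n.+1 k (coface b n k c).
Proof. by rewrite /coface !gfun_yon; case: b. Qed.

Lemma Pi_src_glob n (s : Pi_cell n.+2) : Pi_src (Pi_src s) = Pi_src (Pi_tgt s).
Proof.
apply: Pi_cell_ext => [|k c a H H']; first exact: src_glob.
rewrite /=; f_equal; apply: pb_cell_ext; last by [].
exact: (coface_glob false c).
Qed.

Lemma Pi_tgt_glob n (s : Pi_cell n.+2) : Pi_tgt (Pi_src s) = Pi_tgt (Pi_tgt s).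
Proof.
apply: Pi_cell_ext => [|k c a H H']; first exact: tgt_glob.
rewrite /=; f_equal; apply: pb_cell_ext; last by [].
exact: (coface_glob true c).
Qed.

Definition Pi_glob : globset := @GlobSet Pi_cell Pi_src Pi_tgt Pi_src_glob Pi_tgt_glob.

Definition Pi_proj : gmap Pi_glob B :=
  @GMap Pi_glob B (fun _ s => projT1 s) (fun _ _ => erefl) (fun _ _ => erefl).

Definition Pi : slice B := Slice Pi_proj.

(* The universal property of Pi: composition with the counit Pi_ev is a
   bijection from slice_hom Z Pi to slice_hom (pbf phi Z) E.                *)

Definition Pi_ev_fun n (x : pbf phi Pi n) : E n :=
  projT2 (sval x).1 n (exist _ (gc_top, (sval x).2) (svalP x)).

Lemma Pi_ev_src n (x : pbf phi Pi n.+1) : Pi_ev_fun (src x) = src (Pi_ev_fun x).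
Proof.
case: x => [[[b h] a] H]; rewrite /Pi_ev_fun -gfun_src /=.
by congr (h n _); apply: pb_cell_ext.
Qed.

Lemma Pi_ev_tgt n (x : pbf phi Pi n.+1) : Pi_ev_fun (tgt x) = tgt (Pi_ev_fun x).
Proof.
case: x => [[[b h] a] H]; rewrite /Pi_ev_fun -gfun_tgt /=.
by congr (h n _); apply: pb_cell_ext.
Qed.

Definition Pi_ev_gmap : gmap (pbf phi Pi) E :=
  @GMap (pbf phi Pi) E Pi_ev_fun Pi_ev_src Pi_ev_tgt.

Lemma Pi_ev_comm : proj E \og Pi_ev_gmap = proj (pbf phi Pi).
Proof.
by apply: gmap_ext => n [[[b h] a] H]; apply: (slice_homP h).
Qed.

Definition Pi_ev : slice_hom (pbf phi Pi) E :=
  @SliceHom A (pbf phi Pi) E Pi_ev_gmap Pi_ev_comm.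

Section Transpose.
Context (Z : slice B) (f : slice_hom (pbf phi Z) E).

Lemma yon_over n (z : Z n) :
  proj Z \og yon z = proj (globe_over (proj Z n z)).
Proof. by apply: gmap_ext => k c; apply: (gfun_yon (proj Z)). Qed.

Definition Pi_tr_fun n (z : Z n) : Pi_cell n :=
  existT _ (proj Z n z)
    (f \os pbf_map phi (@SliceHom B (globe_over (proj Z n z)) Z (yon z) (yon_over z))).

Lemma Pi_tr_src n (z : Z n.+1) : Pi_tr_fun (src z) = Pi_src (Pi_tr_fun z).
Proof.
apply: Pi_cell_ext => [|k c a H H']; first exact: gfun_src.
rewrite /=; f_equal; apply: pb_cell_ext; last by [].
by apply/esym/(gfun_yon (yon z)).
Qed.

Lemma Pi_tr_tgt n (z : Z n.+1) : Pi_tr_fun (tgt z) = Pi_tgt (Pi_tr_fun z).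
Proof.
apply: Pi_cell_ext => [|k c a H H']; first exact: gfun_tgt.
rewrite /=; f_equal; apply: pb_cell_ext; last by [].
by apply/esym/(gfun_yon (yon z)).
Qed.

Definition Pi_tr_gmap : gmap Z Pi := @GMap Z Pi Pi_tr_fun Pi_tr_src Pi_tr_tgt.

Lemma Pi_tr_comm : proj Pi \og Pi_tr_gmap = proj Z.
Proof. exact: gmap_ext. Qed.

Definition Pi_tr : slice_hom Z Pi := @SliceHom B Z Pi Pi_tr_gmap Pi_tr_comm.

Lemma Pi_tr_ev : Pi_ev \os pbf_map phi Pi_tr = f.
Proof.
apply: slice_hom_ext; apply: gmap_ext => n [[z a] H] /=.
by rewrite /Pi_ev_fun /=; congr (f n _); apply: pb_cell_ext.
Qed.

End Transpose.

Lemma isrc_globe n k (p : lt_dim k n) m (q : lt_dim n m) b (r : lt_dim k m) :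
  isrc p (gc_bd q b : globe m n) = gc_bd r false.
Proof.
elim: p q b r => [|j p IH] q b r /=; first by rewrite (lt_dim_irr r (ltd_pred q)).
exact: IH.
Qed.

Lemma itgt_globe n k (p : lt_dim k n) m (q : lt_dim n m) b (r : lt_dim k m) :
  itgt p (gc_bd q b : globe m n) = gc_bd r true.
Proof.
elim: p q b r => [|j p IH] q b r /=; first by rewrite (lt_dim_irr r (ltd_pred q)).
exact: IH.
Qed.

Lemma Pi_yon n (s : Pi n) k (c : globe n k) (a : A k) H H' :
  projT2 (yon s k c) k (exist _ (gc_top, a) H) = projT2 s k (exist _ (c, a) H').
Proof.
case: c a H H' => [|j p b] a H H'; first by rewrite (proof_irrelevance _ H H').
case: b H H' => /=; elim: p s => [|m q IH] s H H'.
- by rewrite /=; f_equal; apply: pb_cell_ext.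
- have H2 : proj (globe_over (tgt (projT1 s))) _ (gc_bd q true) = phi _ a.
    by rewrite -H'.
  rewrite [LHS](IH (Pi_tgt s) H H2).
  rewrite /=; f_equal; apply: pb_cell_ext; last by [].
  exact: itgt_globe.
- by rewrite /=; f_equal; apply: pb_cell_ext.
- have H2 : proj (globe_over (src (projT1 s))) _ (gc_bd q false) = phi _ a.
    by rewrite -H'.
  rewrite [LHS](IH (Pi_src s) H H2).
  rewrite /=; f_equal; apply: pb_cell_ext; last by [].
  exact: isrc_globe.
Qed.

Lemma Pi_tr_uniq (Z : slice B) (f : slice_hom (pbf phi Z) E) (g : slice_hom Z Pi) :
  Pi_ev \os pbf_map phi g = f -> g = Pi_tr f.
Proof.
move=> <-; apply: slice_hom_ext; apply: gmap_ext => n z.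
apply: Pi_cell_ext => [|k c a H H']; first exact: (slice_homP g).
have aux (t : Pi k) : t = yon (g n z) k c -> forall H2,
    projT2 (g n z) k (exist _ (c, a) H) = projT2 t k (exist _ (gc_top, a) H2).
  by move=> -> H2; rewrite (Pi_yon H2 H).
exact: (aux _ (gfun_yon g z c)).
Qed.

End DependentProduct.

Fixpoint iid (X : globset) (i : forall n, X n -> X n.+1) k n (p : lt_dim k n) :
    X k -> X n :=
  match p in lt_dim _ m return X k -> X m with
  | ltd_S => fun x => i k x
  | ltd_up m q => fun x => i m (iid i q x)
  end.

(* ocomp p a b _ is the composite of a after b along their common boundary of
   dimension k, in applicative order: it requires s^(n-k) a = t^(n-k) b. In
   the axioms, a law is required whenever both of its sides are defined.    *)
Record ocat := OCat {
  oglob :> globset;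
  oid : forall n, oglob n -> oglob n.+1;
  ocomp : forall k n (p : lt_dim k n) (a b : oglob n),
    isrc p a = itgt p b -> oglob n;
  oid_src : forall n (a : oglob n), src (oid a) = a;
  oid_tgt : forall n (a : oglob n), tgt (oid a) = a;
  ocomp_src0 : forall n (a b : oglob n.+1) (H : isrc ltd_S a = itgt ltd_S b),
    src (ocomp H) = src b;
  ocomp_tgt0 : forall n (a b : oglob n.+1) (H : isrc ltd_S a = itgt ltd_S b),
    tgt (ocomp H) = tgt a;
  ocomp_srcS : forall k n (p : lt_dim k n) (a b : oglob n.+1)
    (H : isrc (ltd_up p) a = itgt (ltd_up p) b)
    (H' : isrc p (src a) = itgt p (src b)),
    src (ocomp H) = ocomp H';
  ocomp_tgtS : forall k n (p : lt_dim k n) (a b : oglob n.+1)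
    (H : isrc (ltd_up p) a = itgt (ltd_up p) b)
    (H' : isrc p (tgt a) = itgt p (tgt b)),
    tgt (ocomp H) = ocomp H';
  ocomp_assoc : forall k n (p : lt_dim k n) (a b c : oglob n)
    (Hab : isrc p a = itgt p b) (Hbc : isrc p b = itgt p c)
    (H : isrc p (ocomp Hab) = itgt p c) (H' : isrc p a = itgt p (ocomp Hbc)),
    ocomp H = ocomp H';
  ocomp_idl : forall k n (p : lt_dim k n) (a : oglob n)
    (H : isrc p (iid oid p (itgt p a)) = itgt p a), ocomp H = a;
  ocomp_idr : forall k n (p : lt_dim k n) (a : oglob n)
    (H : isrc p a = itgt p (iid oid p (isrc p a))), ocomp H = a;
  ocomp_oid : forall k n (p : lt_dim k n) (a b : oglob n)
    (H : isrc p a = itgt p b)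
    (H' : isrc (ltd_up p) (oid a) = itgt (ltd_up p) (oid b)),
    oid (ocomp H) = ocomp H';
  ocomp_interchange : forall j k n (p : lt_dim j k) (q : lt_dim k n)
    (r : lt_dim j n) (a b a' b' : oglob n)
    (Hab : isrc q a = itgt q b) (Hab' : isrc q a' = itgt q b')
    (Haa : isrc r a = itgt r a') (Hbb : isrc r b = itgt r b')
    (H : isrc r (ocomp Hab) = itgt r (ocomp Hab'))
    (H' : isrc q (ocomp Haa) = itgt q (ocomp Hbb)),
    ocomp H = ocomp H' }.

Arguments ocomp {o k n} p a b _.
Arguments oid {o n} _.

Record ofunctor (C D : ocat) := OFunctor {
  ofmap :> gmap C D;
  of_id : forall n (a : C n), ofmap n.+1 (oid a) = oid (ofmap n a);
  of_comp : forall k n (p : lt_dim k n) (a b : C n) (H : isrc p a = itgt p b)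
    (H' : isrc p (ofmap n a) = itgt p (ofmap n b)),
    ofmap n (ocomp p a b H) = ocomp p (ofmap n a) (ofmap n b) H' }.

Definition ofid (C : ocat) : ofunctor C C.
Proof.
by exists (gid C) => //= k n p a b H H'; rewrite (proof_irrelevance _ H H').
Defined.

Definition ofcomp (C D K : ocat) (g : ofunctor D K) (f : ofunctor C D) :
  ofunctor C K.
Proof.
exists (g \og f) => [n a|k n p a b H H'] /=; first by rewrite !of_id.
have H1 : isrc p (f n a) = itgt p (f n b) by rewrite -gfun_isrc -gfun_itgt H.
by rewrite (of_comp H H1) (of_comp H1 H').
Defined.

Record free_ocat (X : globset) := FreeOCat {
  free_cat :> ocat;
  free_gen : gmap X free_cat;
  free_ext : forall C : ocat, gmap X C -> ofunctor free_cat C;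
  free_ext_gen : forall (C : ocat) (f : gmap X C), free_ext f \og free_gen = f;
  free_ext_uniq : forall (C : ocat) (g h : ofunctor free_cat C),
    g \og free_gen = h \og free_gen -> (g : gmap free_cat C) = h }.

Module FreeExistence.

Section Terms.
Context (X : globset).

Inductive tm : nat -> Type :=
  | tgen n of X n : tm n
  | tid n of tm n : tm n.+1
  | tcomp k n of lt_dim k n & tm n & tm n : tm n.

Definition gen_bd (d : bool) n : X n -> tm n.-1 :=
  match n return X n -> tm n.-1 with
  | 0 => fun x => tgen x
  | m.+1 => fun x => tgen (if d then tgt x else src x)
  end.

Definition comp_bd (d : bool) k n (p : lt_dim k n) :
    tm n.-1 -> tm n.-1 -> tm n.-1 :=
  match p in lt_dim _ m return tm m.-1 -> tm m.-1 -> tm m.-1 with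
  | ltd_S => fun da db => if d then da else db
  | ltd_up m q => fun da db => tcomp q da db
  end.

Fixpoint tbd (d : bool) n (t : tm n) : tm n.-1 :=
  match t in tm m return tm m.-1 with
  | tgen n x => gen_bd d x
  | tid n a => a
  | tcomp k n p a b => comp_bd d p (tbd d a) (tbd d b)
  end.

Fixpoint tibd (d : bool) k n (p : lt_dim k n) : tm n -> tm k :=
  match p in lt_dim _ m return tm m -> tm k with
  | ltd_S => fun t => tbd d t
  | ltd_up _ q => fun t => tibd d q (tbd d t)
  end.

Fixpoint tiid k n (p : lt_dim k n) : tm k -> tm n :=
  match p in lt_dim _ m return tm k -> tm m with
  | ltd_S => fun t => tid t
  | ltd_up _ q => fun t => tid (tiid q t)
  end.

Inductive teq : forall n, tm n -> tm n -> Prop :=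
  | te_sym n (a b : tm n) : teq a b -> teq b a
  | te_trans n (a b c : tm n) : teq a b -> teq b c -> teq a c
  | te_gen n (x : X n) : teq (tgen x) (tgen x)
  | te_id n (a a' : tm n) : teq a a' -> teq (tid a) (tid a')
  | te_comp k n (p : lt_dim k n) (a a' b b' : tm n) :
      teq a a' -> teq b b' -> teq (tibd false p a) (tibd true p b) ->
      teq (tcomp p a b) (tcomp p a' b')
  | te_bd d n (a a' : tm n.+1) : teq a a' -> teq (tbd d a) (tbd d a')
  | te_glob d n (a : tm n.+2) : teq a a ->
      teq (tbd d (tbd false a)) (tbd d (tbd true a))
  | te_assoc k n (p : lt_dim k n) (a b c : tm n) :
      teq (tcomp p (tcomp p a b) c) (tcomp p (tcomp p a b) c) ->
      teq (tcomp p a (tcomp p b c)) (tcomp p a (tcomp p b c)) ->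
      teq (tcomp p (tcomp p a b) c) (tcomp p a (tcomp p b c))
  | te_idl k n (p : lt_dim k n) (a : tm n) : teq a a ->
      teq (tcomp p (tiid p (tibd true p a)) a)
          (tcomp p (tiid p (tibd true p a)) a) ->
      teq (tcomp p (tiid p (tibd true p a)) a) a
  | te_idr k n (p : lt_dim k n) (a : tm n) : teq a a ->
      teq (tcomp p a (tiid p (tibd false p a)))
          (tcomp p a (tiid p (tibd false p a))) ->
      teq (tcomp p a (tiid p (tibd false p a))) a
  | te_idcomp k n (p : lt_dim k n) (a b : tm n) :
      teq (tid (tcomp p a b)) (tid (tcomp p a b)) ->
      teq (tcomp (ltd_up p) (tid a) (tid b)) (tcomp (ltd_up p) (tid a) (tid b)) ->
      teq (tid (tcomp p a b)) (tcomp (ltd_up p) (tid a) (tid b))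
  | te_inter j k n (p : lt_dim j k) (q : lt_dim k n) (r : lt_dim j n)
      (a b a' b' : tm n) :
      teq (tcomp r (tcomp q a b) (tcomp q a' b'))
          (tcomp r (tcomp q a b) (tcomp q a' b')) ->
      teq (tcomp q (tcomp r a a') (tcomp r b b'))
          (tcomp q (tcomp r a a') (tcomp r b b')) ->
      teq (tcomp r (tcomp q a b) (tcomp q a' b'))
          (tcomp q (tcomp r a a') (tcomp r b b')).

Lemma teq_reflL n (a b : tm n) : teq a b -> teq a a.
Proof. by move=> H; apply: te_trans H (te_sym H). Qed.

Lemma teq_reflR n (a b : tm n) : teq a b -> teq b b.
Proof. by move=> H; apply: te_trans (te_sym H) H. Qed.

Lemma te_ibd d k n (p : lt_dim k n) (a b : tm n) :
  teq a b -> teq (tibd d p a) (tibd d p b).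
Proof. by elim: p a b => [|m q IH] a b H /=; [|apply: IH]; apply: te_bd. Qed.

Lemma te_iid k n (p : lt_dim k n) (a b : tm k) :
  teq a b -> teq (tiid p a) (tiid p b).
Proof. by elim: p => [|m q IH] H /=; apply: te_id => //; apply: IH. Qed.

Lemma te_iglob d k n (p : lt_dim k n) (a : tm n.+1) : teq a a ->
  teq (tibd d p (tbd false a)) (tibd d p (tbd true a)).
Proof.
case: p a => [|m q] a H /=; first exact: te_glob.
by apply: te_ibd; apply: te_glob.
Qed.

Fixpoint wf n (t : tm n) : Prop :=
  match t with
  | tgen _ _ => True
  | tid _ a => teq a a /\ wf a
  | tcomp _ _ p a b => [/\ teq a a, wf a, teq b b, wf b &
      teq (tibd false p a) (tibd true p b)]
  end.

Lemma wf_bd d n (t : tm n) : 0 < n -> wf t -> wf (tbd d t).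
Proof.
elim: t => [[|m] x|m a IH|k m p a IHa b IHb] //= Hm; first by case.
case=> Ha Wa Hb Wb; move: (IHa Hm Wa) (IHb Hm Wb) => {IHa IHb}.
case: p a b Ha Hb {Wa Wb Hm} => [|i q] a b Ha Hb /= Wa Wb H; first by case: d Wa Wb.
split=> //; try exact: te_bd.
case: d {Wa Wb}; last by apply: te_trans H _; apply/te_sym/te_iglob.
by apply: te_trans H; apply/te_sym/te_iglob.
Qed.

Lemma teq_wf n (a b : tm n) : teq a b -> wf a /\ wf b.
Proof.
elim=> {n a b}; try by move=> *; tauto.
- by [].
- by move=> n a a' H [Wa Wa'] /=; do !split=> //; [apply: teq_reflL H | apply: teq_reflR H].
- move=> k n p a a' b b' Ha [Wa Wa'] Hb [Wb Wb'] H _ /=.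
  have [Ea Ea' Eb Eb'] := And4 (teq_reflL Ha) (teq_reflR Ha) (teq_reflL Hb) (teq_reflR Hb).
  split; split=> //.
  by apply: te_trans (te_ibd _ _ (te_sym Ha)) _; apply: te_trans H _; apply: te_ibd.
- by move=> d n a a' _ [Wa Wa']; split; apply: wf_bd.
- by move=> d n a _ [Wa _]; split; do 2 apply: wf_bd => //.
Qed.

Definition fcell n : Type := {P : tm n -> Prop | exists t, teq t t /\ P = teq t}.

Lemma fcell_ext n (c c' : fcell n) : sval c = sval c' -> c = c'.
Proof.
case: c c' => [P HP] [Q HQ] /= E; subst Q.
by rewrite (proof_irrelevance _ HP HQ).
Qed.

Definition cls n (t : tm n) (H : teq t t) : fcell n :=
  exist _ (teq t) (ex_intro _ t (conj H erefl)).

Lemma cls_eq n (t t' : tm n) (H : teq t t) (H' : teq t' t') :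
  teq t t' -> cls H = cls H'.
Proof.
move=> E; apply: fcell_ext.
apply: functional_extensionality => u; apply: propositional_extensionality.
by split=> Hu; [apply: te_trans (te_sym E) Hu | apply: te_trans E Hu].
Qed.

Lemma cls_inj n (t t' : tm n) (H : teq t t) (H' : teq t' t') :
  cls H = cls H' -> teq t t'.
Proof. by case=> E; rewrite E. Qed.

Definition rep n (c : fcell n) : tm n :=
  sval (constructive_indefinite_description _ (svalP c)).

Lemma rep_refl n (c : fcell n) : teq (rep c) (rep c).
Proof. by rewrite /rep; case: constructive_indefinite_description => t []. Qed.

Lemma repK n (c : fcell n) : cls (rep_refl c) = c.
Proof.
apply: fcell_ext; rewrite /= /rep; by case: constructive_indefinite_description => t /= [_ E].
Qed.

Lemma rep_cls n (t : tm n) (H : teq t t) : teq (rep (cls H)) t.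
Proof. by apply: (cls_inj (H := rep_refl (cls H)) (H' := H)); rewrite repK. Qed.

Lemma fcell_ind n (P : fcell n -> Prop) :
  (forall t (H : teq t t), P (cls H)) -> forall c, P c.
Proof. by move=> H c; rewrite -(repK c). Qed.

Lemma clsP n (c : fcell n) : exists t (H : teq t t), c = cls H.
Proof. by exists (rep c), (rep_refl c); rewrite repK. Qed.

Definition fbd d n (c : fcell n.+1) : fcell n := cls (te_bd d (rep_refl c)).

Lemma fbd_cls d n (t : tm n.+1) (H : teq t t) : fbd d (cls H) = cls (te_bd d H).
Proof. by apply: cls_eq; apply: te_bd; apply: rep_cls. Qed.

Lemma fbd_bd d n (c : fcell n.+2) : fbd d (fbd false c) = fbd d (fbd true c).
Proof.
by elim/fcell_ind: c => t H; rewrite !fbd_cls; apply: cls_eq; apply: te_glob.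
Qed.

Definition fglob : globset :=
  @GlobSet fcell (fbd false) (fbd true) (fbd_bd false) (fbd_bd true).

Lemma isrc_cls k n (p : lt_dim k n) (t : tm n) (H : teq t t) :
  isrc p (cls H : fglob n) = cls (te_ibd false p H).
Proof.
elim: p t H => [|m q IH] t H /=; first by rewrite fbd_cls; apply/cls_eq/te_bd.
by rewrite fbd_cls IH; apply/cls_eq/te_ibd/te_bd.
Qed.

Lemma itgt_cls k n (p : lt_dim k n) (t : tm n) (H : teq t t) :
  itgt p (cls H : fglob n) = cls (te_ibd true p H).
Proof.
elim: p t H => [|m q IH] t H /=; first by rewrite fbd_cls; apply/cls_eq/te_bd.
by rewrite fbd_cls IH; apply/cls_eq/te_ibd/te_bd.
Qed.

Definition fid n (c : fcell n) : fcell n.+1 := cls (te_id (rep_refl c)).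

Lemma fid_cls n (t : tm n) (H : teq t t) : fid (cls H) = cls (te_id H).
Proof. by apply: cls_eq; apply: te_id; apply: rep_cls. Qed.

Lemma iid_cls k n (p : lt_dim k n) (t : tm k) (H : teq t t) :
  @iid fglob fid k n p (cls H) = cls (te_iid p H).
Proof.
elim: p => [|m q IH] /=; first by rewrite fid_cls; apply/cls_eq/te_id.
by rewrite IH fid_cls; apply/cls_eq/te_id/te_iid.
Qed.

Lemma fcomp_subproof k n (p : lt_dim k n) (a b : fglob n) :
  isrc p a = itgt p b -> teq (tibd false p (rep a)) (tibd true p (rep b)).
Proof.
by rewrite -{1}(repK a) -{1}(repK b) isrc_cls itgt_cls => /cls_inj.
Qed.

Definition fcomp k n (p : lt_dim k n) (a b : fglob n)
    (H : isrc p a = itgt p b) : fglob n :=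
  cls (te_comp (rep_refl a) (rep_refl b) (fcomp_subproof H)).

Lemma comp_wd k n (p : lt_dim k n) (t u : tm n) (Ht : teq t t) (Hu : teq u u)
  (H : isrc p (cls Ht : fglob n) = itgt p (cls Hu : fglob n)) :
  teq (tcomp p t u) (tcomp p t u).
Proof.
by apply: te_comp => //; move: H; rewrite isrc_cls itgt_cls => /cls_inj.
Qed.

Lemma fcomp_cls k n (p : lt_dim k n) (t u : tm n) (Ht : teq t t) (Hu : teq u u)
  (H : isrc p (cls Ht : fglob n) = itgt p (cls Hu : fglob n)) :
  fcomp H = cls (comp_wd H).
Proof.
apply: cls_eq; apply: te_comp; try exact: rep_cls.
exact: fcomp_subproof.
Qed.

Lemma fcompE k n (p : lt_dim k n) (a b a' b' : fglob n)
  (H : isrc p a = itgt p b) (H' : isrc p a' = itgt p b') :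
  a = a' -> b = b' -> fcomp H = fcomp H'.
Proof. by move=> Ea Eb; subst a' b'; rewrite (proof_irrelevance _ H H'). Qed.

Definition fcat : ocat.
Proof.
apply: (@OCat fglob (@fid) (@fcomp)).
- by move=> n; move=> ca; have [a [Ha ->]] := clsP ca; rewrite fid_cls [LHS]fbd_cls; apply: cls_eq.
- by move=> n; move=> ca; have [a [Ha ->]] := clsP ca; rewrite fid_cls [LHS]fbd_cls; apply: cls_eq.
- move=> n; move=> ca; have [a [Ha ->]] := clsP ca; move=> cb; have [b [Hb ->]] := clsP cb => H.
  by rewrite fcomp_cls /= !fbd_cls; apply: cls_eq; apply: (te_bd false Hb).
- move=> n; move=> ca; have [a [Ha ->]] := clsP ca; move=> cb; have [b [Hb ->]] := clsP cb => H.
  by rewrite fcomp_cls /= !fbd_cls; apply: cls_eq; apply: (te_bd true Ha).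
- move=> k n p; move=> ca; have [a [Ha ->]] := clsP ca; move=> cb; have [b [Hb ->]] := clsP cb => H H'.
  rewrite fcomp_cls [LHS]fbd_cls.
  have E1 : src (cls Ha : fglob n.+1) = cls (te_bd false Ha) by apply: fbd_cls.
  have E2 : src (cls Hb : fglob n.+1) = cls (te_bd false Hb) by apply: fbd_cls.
  have H1 : isrc p (cls (te_bd false Ha) : fglob n) = itgt p (cls (te_bd false Hb) : fglob n).
    by rewrite -E1 -E2.
  rewrite (fcompE H' H1 E1 E2) fcomp_cls; apply: cls_eq.
  exact: (te_bd false (comp_wd H)).
- move=> k n p; move=> ca; have [a [Ha ->]] := clsP ca; move=> cb; have [b [Hb ->]] := clsP cb => H H'.
  rewrite fcomp_cls [LHS]fbd_cls.
  have E1 : tgt (cls Ha : fglob n.+1) = cls (te_bd true Ha) by apply: fbd_cls.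
  have E2 : tgt (cls Hb : fglob n.+1) = cls (te_bd true Hb) by apply: fbd_cls.
  have H1 : isrc p (cls (te_bd true Ha) : fglob n) = itgt p (cls (te_bd true Hb) : fglob n).
    by rewrite -E1 -E2.
  rewrite (fcompE H' H1 E1 E2) fcomp_cls; apply: cls_eq.
  exact: (te_bd true (comp_wd H)).
- move=> k n p; move=> ca; have [a [Ha ->]] := clsP ca; move=> cb; have [b [Hb ->]] := clsP cb.
  move=> cc; have [c [Hc ->]] := clsP cc => Hab Hbc; rewrite !fcomp_cls => H H'.
  by rewrite !fcomp_cls; apply: cls_eq; apply: te_assoc; [apply: (comp_wd H) | apply: (comp_wd H')].
- move=> k n p; move=> ca; have [a [Ha ->]] := clsP ca.
  have E : @iid fglob (@fid) k n p (itgt p (cls Ha : fglob n)) =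
      cls (te_iid p (te_ibd true p Ha)) :> fglob n by rewrite itgt_cls iid_cls.
  rewrite E => H.
  by rewrite fcomp_cls; apply: cls_eq; apply: te_idl => //; apply: (comp_wd H).
- move=> k n p; move=> ca; have [a [Ha ->]] := clsP ca.
  have E : @iid fglob (@fid) k n p (isrc p (cls Ha : fglob n)) =
      cls (te_iid p (te_ibd false p Ha)) :> fglob n by rewrite isrc_cls iid_cls.
  rewrite E => H.
  by rewrite fcomp_cls; apply: cls_eq; apply: te_idr => //; apply: (comp_wd H).
- move=> k n p; move=> ca; have [a [Ha ->]] := clsP ca; move=> cb; have [b [Hb ->]] := clsP cb => H.
  rewrite fcomp_cls !fid_cls => H'; rewrite fcomp_cls; apply: cls_eq.
  by apply: te_idcomp; [apply: te_id (comp_wd H) | apply: (comp_wd H')].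
- move=> j k n p q r; move=> ca; have [a [Ha ->]] := clsP ca; move=> cb; have [b [Hb ->]] := clsP cb.
  move=> ca'; have [a' [Ha' ->]] := clsP ca'; move=> cb'; have [b' [Hb' ->]] := clsP cb' => Hab Hab' Haa Hbb.
  rewrite !fcomp_cls => H H'; rewrite !fcomp_cls; apply: cls_eq.
  by apply: (te_inter p); [apply: (comp_wd H) | apply: (comp_wd H')].
Defined.

Definition fgen : gmap X fcat.
Proof.
exists (fun n x => cls (te_gen x)) => n x.
  by rewrite [RHS]fbd_cls; apply/cls_eq/te_gen.
by rewrite [RHS]fbd_cls; apply/cls_eq/te_gen.
Defined.

Section Extension.
Context (C : ocat) (f : gmap X C).

Definition ocomp_opt k n (p : lt_dim k n) (a b : C n) : option (C n) :=
  match excluded_middle_informative (isrc p a = itgt p b) with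
  | left H => Some (ocomp p a b H)
  | right _ => None
  end.

Lemma ocomp_optE k n (p : lt_dim k n) (a b : C n) H :
  ocomp_opt p a b = Some (ocomp p a b H).
Proof.
rewrite /ocomp_opt; case: excluded_middle_informative => // H'.
by rewrite (proof_irrelevance _ H H').
Qed.

Fixpoint interp n (t : tm n) : option (C n) :=
  match t in tm m return option (C m) with
  | tgen n x => Some (f n x)
  | tid n a => omap oid (interp a)
  | tcomp k n p a b =>
      obind (fun u => obind (fun v => ocomp_opt p u v) (interp b)) (interp a)
  end.

Lemma interp_comp k n (p : lt_dim k n) (a b : tm n) c :
  interp (tcomp p a b) = Some c ->
  exists u v (H : isrc p u = itgt p v),
    [/\ interp a = Some u, interp b = Some v & c = ocomp p u v H].
Proof.
rewrite /=; case: (interp a) => //= u; case: (interp b) => //= v.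
rewrite /ocomp_opt; case: excluded_middle_informative => // H [<-].
by exists u, v, H.
Qed.

Lemma interp_bd d n (t : tm n.+1) c :
  interp t = Some c -> interp (tbd d t) = Some (if d then tgt c else src c).
Proof.
pose Q m := match m return tm m -> Prop with
  | 0 => fun _ => True
  | m'.+1 => fun t : tm m'.+1 => forall c, interp t = Some c ->
      interp (tbd d t) = Some (if d then tgt c else src c)
  end.
suff: Q n.+1 t by apply.
elim: t => [[|m] x|m a _|k m p a IHa b IHb] //=.
- by move=> _ [<-]; case: d {Q}; rewrite ?gfun_src ?gfun_tgt.
- by case: (interp a) => //= u _ [<-]; case: d {Q}; rewrite ?oid_src ?oid_tgt.
case: p a b IHa IHb => [|i q] a b IHa IHb e /interp_comp [u [v [H [Ea Eb ->]]]].
  by case: d @Q IHa IHb => /= IHa IHb; rewrite ?ocomp_src0 ?ocomp_tgt0; auto.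
move: (IHa _ Ea) (IHb _ Eb) => /= -> ->; case: d {Q IHa IHb} => /=.
  have H' : isrc q (tgt u) = itgt q (tgt v) by rewrite isrc_glob; apply: H.
  by rewrite (ocomp_optE H') (ocomp_tgtS H H').
have H' : isrc q (src u) = itgt q (src v) by rewrite itgt_glob; apply: H.
by rewrite (ocomp_optE H') (ocomp_srcS H H').
Qed.

Lemma interp_isrc k n (p : lt_dim k n) (t : tm n) c :
  interp t = Some c -> interp (tibd false p t) = Some (isrc p c).
Proof. by elim: p t c => [|m q IH] t c H /=; [|apply: IH]; apply: (interp_bd false H). Qed.

Lemma interp_itgt k n (p : lt_dim k n) (t : tm n) c :
  interp t = Some c -> interp (tibd true p t) = Some (itgt p c).
Proof. by elim: p t c => [|m q IH] t c H /=; [|apply: IH]; apply: (interp_bd true H). Qed.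

Lemma interp_iid k n (p : lt_dim k n) (t : tm k) c :
  interp t = Some c -> interp (tiid p t) = Some (iid (@oid C) p c).
Proof. by move=> H; elim: p => [|m q IH] /=; rewrite ?H ?IH. Qed.

Lemma interp_sound n (t t' : tm n) :
  teq t t' -> exists c, interp t = Some c /\ interp t' = Some c.
Proof.
elim=> {n t t'}.
- by move=> n a b _ [c [Ha Hb]]; exists c.
- by move=> n a b c _ [u [Ha Hb]] _ [v [Hb' Hc]]; exists u; rewrite Ha Hc -Hb Hb'.
- by move=> n x; exists (f n x).
- by move=> n a a' _ [u [Ha Ha']]; exists (oid u); rewrite /= Ha Ha'.
- move=> k n p a a' b b' _ [u [Ha Ha']] _ [v [Hb Hb']] _ [w [H1 H2]].
  have H : isrc p u = itgt p v.
    by apply: Some_inj; rewrite -(interp_isrc p Ha) -(interp_itgt p Hb) H1 H2.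
  by exists (ocomp p u v H); rewrite /= Ha Ha' Hb Hb' /= !(ocomp_optE H).
- move=> d n a a' _ [u [Ha Ha']]; exists (if d then tgt u else src u).
  by rewrite (interp_bd d Ha) (interp_bd d Ha').
- move=> d n a _ [u [Ha _]].
  exists (if d then tgt (src u) else src (src u)).
  rewrite (interp_bd d (interp_bd false Ha)) (interp_bd d (interp_bd true Ha)).
  by case: d; rewrite ?src_glob ?tgt_glob.
- move=> k n p a b c _ [u [Hu _]] _ [v [Hv _]]; exists u.
  suff E : u = v by rewrite Hu Hv -E.
  case/interp_comp: Hu => ab [c1 [H1 [/interp_comp[a1 [b1 [H2 [Ea Eb Eab]]]] Ec ->]]].
  case/interp_comp: Hv => a2 [bc [H3 [Ea' /interp_comp[b2 [c2 [H4 [Eb' Ec' Ebc]]]] ->]]].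
  have E1 : a2 = a1 by apply: Some_inj; rewrite -Ea -Ea'.
  have E2 : b2 = b1 by apply: Some_inj; rewrite -Eb -Eb'.
  have E3 : c2 = c1 by apply: Some_inj; rewrite -Ec -Ec'.
  by subst; apply: ocomp_assoc.
- move=> k n p a _ [u [Ha _]] _ [v [Hv _]]; exists u.
  suff E : v = u by rewrite Hv Ha E.
  case/interp_comp: Hv => u1 [u2 [H [E1 E2 ->]]].
  have Eu2 : u2 = u by apply: Some_inj; rewrite -Ha -E2.
  have Eu1 : u1 = iid (@oid C) p (itgt p u).
    by apply: Some_inj; rewrite -E1; apply: interp_iid; apply: interp_itgt.
  by subst; apply: ocomp_idl.
- move=> k n p a _ [u [Ha _]] _ [v [Hv _]]; exists u.
  suff E : v = u by rewrite Hv Ha E.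
  case/interp_comp: Hv => u1 [u2 [H [E1 E2 ->]]].
  have Eu1 : u1 = u by apply: Some_inj; rewrite -Ha -E1.
  have Eu2 : u2 = iid (@oid C) p (isrc p u).
    by apply: Some_inj; rewrite -E2; apply: interp_iid; apply: interp_isrc.
  by subst; apply: ocomp_idr.
- move=> k n p a b _ [u [Hu _]] _ [v [Hv _]]; exists u.
  suff E : u = v by rewrite Hu Hv -E.
  case/interp_comp: Hv => a1 [b1 [H [Ea Eb ->]]].
  move: Hu Ea Eb; rewrite [interp (tid _)]/= [interp (tid a)]/= [interp (tid b)]/=.
  case E : (obind _ _) => [w|] //= [<-].
  case/interp_comp: E => a2 [b2 [H2 [-> -> ->]]] /= [Ea] [Eb]; subst.
  exact: ocomp_oid.
- move=> j k n p q r a b a' b' _ [u [Hu _]] _ [v [Hv _]]; exists u.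
  suff E : u = v by rewrite Hu Hv -E.
  case/interp_comp: Hu => x1 [x2 [H1 [/interp_comp[a1 [b1 [H2 [Ea Eb Ex1]]]]
    /interp_comp[a1' [b1' [H3 [Ea' Eb' Ex2]]]] ->]]].
  case/interp_comp: Hv => x3 [x4 [H4 [/interp_comp[a2 [a2' [H5 [Fa Fa' Ex3]]]]
    /interp_comp[b2 [b2' [H6 [Fb Fb' Ex4]]]] ->]]].
  have E1 : a2 = a1 by apply: Some_inj; rewrite -Ea -Fa.
  have E2 : b2 = b1 by apply: Some_inj; rewrite -Eb -Fb.
  have E3 : a2' = a1' by apply: Some_inj; rewrite -Ea' -Fa'.
  have E4 : b2' = b1' by apply: Some_inj; rewrite -Eb' -Fb'.
  by subst; apply: (ocomp_interchange p).
Qed.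

Lemma interp_rep n (c : fcell n) : exists v, interp (rep c) = Some v.
Proof. by have [v [H _]] := interp_sound (rep_refl c); exists v. Qed.

Definition ext_fun n (c : fcat n) : C n :=
  sval (constructive_indefinite_description _ (interp_rep c)).

Lemma ext_fun_cls n (t : tm n) (H : teq t t) c :
  interp t = Some c -> ext_fun (cls H : fcat n) = c.
Proof.
move=> Hc; rewrite /ext_fun; case: constructive_indefinite_description => v /= Hv.
have [w [H1 H2]] := interp_sound (rep_cls H).
by apply: Some_inj; rewrite -Hv -Hc H1 H2.
Qed.

Lemma ext_bd d n (c : fcat n.+1) :
  ext_fun (fbd d c : fcat n) = if d then tgt (ext_fun c) else src (ext_fun c).
Proof.
have [t [H ->]] := clsP c; have [v [Hv _]] := interp_sound H.
by rewrite fbd_cls (ext_fun_cls H Hv); apply: ext_fun_cls; apply: interp_bd.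
Qed.

Definition ext_gmap : gmap fcat C :=
  @GMap fcat C ext_fun (ext_bd false) (ext_bd true).

Definition ext : ofunctor fcat C.
Proof.
exists ext_gmap => [n|k n p].
  move=> ct; have [t [H ->]] := clsP ct; have [v [Hv _]] := interp_sound H.
  rewrite [oid _]fid_cls /= (ext_fun_cls H Hv); apply: ext_fun_cls.
  by rewrite /= Hv.
move=> ca; have [a [Ha ->]] := clsP ca; move=> cb; have [b [Hb ->]] := clsP cb => H.
have [u [Hu _]] := interp_sound Ha; have [v [Hv _]] := interp_sound Hb.
rewrite /= (ext_fun_cls Ha Hu) (ext_fun_cls Hb Hv) => H'.
rewrite fcomp_cls; apply: ext_fun_cls.
by rewrite /= Hu Hv /= (ocomp_optE H').
Defined.

Lemma ext_gen : ext \og fgen = f.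
Proof. by apply: gmap_ext => n x; apply: ext_fun_cls. Qed.

End Extension.

Lemma ext_uniq (C : ocat) (g h : ofunctor fcat C) :
  g \og fgen = h \og fgen -> (g : gmap fcat C) = h.
Proof.
move=> E; apply: gmap_ext => n; move=> ct; have [t [H ->]] := clsP ct.
have [W _] := teq_wf H; clear ct; elim: t H W => {n} [n x|n a IH|k n p a IHa b IHb] H W.
- rewrite (cls_eq H (te_gen x)); last exact: te_gen.
  exact: (f_equal (fun u : gmap X C => u n x) E).
- case: W => Ha Wa.
  have -> : (cls H : fcat _) = oid (cls Ha : fcat n).
    by rewrite [RHS]fid_cls; apply: cls_eq.
  by rewrite !of_id (IH Ha Wa).
case: W => Ha Wa Hb Wb Hab.
have H1 : isrc p (cls Ha : fcat n) = itgt p (cls Hb : fcat n).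
  by rewrite [LHS]isrc_cls [RHS]itgt_cls; apply: cls_eq.
have -> : (cls H : fcat _) = ocomp p (cls Ha : fcat n) (cls Hb) H1.
  by rewrite [RHS]fcomp_cls; apply: cls_eq.
have Hg : isrc p (g n (cls Ha)) = itgt p (g n (cls Hb)).
  by rewrite -gfun_isrc -gfun_itgt H1.
have Hh : isrc p (h n (cls Ha)) = itgt p (h n (cls Hb)).
  by rewrite -gfun_isrc -gfun_itgt H1.
rewrite (of_comp H1 Hg) (of_comp H1 Hh).
move: Hg Hh; rewrite (IHa Ha Wa) (IHb Hb Wb) => Hg Hh.
by rewrite (proof_irrelevance _ Hg Hh).
Qed.

Definition free : free_ocat X := FreeOCat ext_gen ext_uniq.

End Terms.
End FreeExistence.

(* Free strict omega-categories are determined only up to unique isomorphism,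
   so the monad T and all that depends on it take a choice F of them as a
   parameter; FreeExistence builds one such choice, by terms modulo provable
   equality.                                                                *)
Definition free_ocats := forall X : globset, free_ocat X.

Definition term_ocats : free_ocats := FreeExistence.free.

Section Monad.
Context (F : free_ocats).

Definition T (X : globset) : globset := F X.

Definition eta (X : globset) : gmap X (T X) := free_gen (F X).

Definition Tfun (X Y : globset) (f : gmap X Y) : ofunctor (F X) (F Y) :=
  free_ext (F X) (eta Y \og f).

Definition Tmap (X Y : globset) (f : gmap X Y) : gmap (T X) (T Y) := Tfun f.

Definition mufun (X : globset) : ofunctor (F (T X)) (F X) :=
  free_ext (F (T X)) (gid (F X)).

Definition mu (X : globset) : gmap (T (T X)) (T X) := mufun X.

Lemma gcompA (A B C D : globset) (h : gmap C D) (g : gmap B C) (f : gmap A B) :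
  h \og (g \og f) = h \og g \og f.
Proof. exact: gmap_ext. Qed.

Lemma gcomp1 (A B : globset) (f : gmap A B) : f \og gid A = f.
Proof. exact: gmap_ext. Qed.

Lemma g1comp (A B : globset) (f : gmap A B) : gid B \og f = f.
Proof. exact: gmap_ext. Qed.

Lemma bang_uniq (A : globset) (f g : gmap A terminal) : f = g.
Proof. by apply: gmap_ext => n x; case: (f n x); case: (g n x). Qed.

Lemma eta_nat (X Y : globset) (f : gmap X Y) : Tmap f \og eta X = eta Y \og f.
Proof. exact: (free_ext_gen (F X)). Qed.

Lemma mu_eta (X : globset) : mu X \og eta (T X) = gid (T X).
Proof. exact: (free_ext_gen (F (T X))). Qed.

Lemma Tmap_id (X : globset) : Tmap (gid X) = gid (T X).
Proof.
apply: (@free_ext_uniq X (F X) (F X) (Tfun (gid X)) (ofid (F X))).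
by rewrite [LHS]eta_nat /= gcomp1 g1comp.
Qed.

Lemma Tmap_comp (X Y Z : globset) (g : gmap Y Z) (f : gmap X Y) :
  Tmap (g \og f) = Tmap g \og Tmap f.
Proof.
apply: (@free_ext_uniq X (F X) (F Z) (Tfun (g \og f)) (ofcomp (Tfun g) (Tfun f))).
rewrite [LHS]eta_nat; apply/esym.
rewrite [LHS](_ : _ = Tmap g \og Tmap f \og eta X) //.
by rewrite -gcompA eta_nat !gcompA eta_nat.
Qed.

Lemma mu_nat (X Y : globset) (f : gmap X Y) :
  mu Y \og Tmap (Tmap f) = Tmap f \og mu X.
Proof.
apply: (@free_ext_uniq _ (F (T X)) (F Y) (ofcomp (mufun Y) (Tfun (Tmap f)))
  (ofcomp (Tfun f) (mufun X))).
rewrite [LHS](_ : _ = mu Y \og Tmap (Tmap f) \og eta (T X)) //.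
rewrite [RHS](_ : _ = Tmap f \og mu X \og eta (T X)) //.
by rewrite -!gcompA mu_eta eta_nat gcompA mu_eta gcomp1 g1comp.
Qed.

Lemma mu_Teta (X : globset) : mu X \og Tmap (eta X) = gid (T X).
Proof.
apply: (@free_ext_uniq _ (F X) (F X) (ofcomp (mufun X) (Tfun (eta X))) (ofid (F X))).
rewrite [LHS](_ : _ = mu X \og Tmap (eta X) \og eta X) //.
by rewrite -gcompA eta_nat gcompA mu_eta.
Qed.

Lemma mu_mu (X : globset) : mu X \og Tmap (mu X) = mu X \og mu (T X).
Proof.
apply: (@free_ext_uniq _ (F (T (T X))) (F X) (ofcomp (mufun X) (Tfun (mu X)))
  (ofcomp (mufun X) (mufun (T X)))).
rewrite [LHS](_ : _ = mu X \og Tmap (mu X) \og eta (T (T X))) //.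
rewrite [RHS](_ : _ = mu X \og mu (T X) \og eta (T (T X))) //.
by rewrite -!gcompA mu_eta eta_nat gcompA mu_eta gcomp1 g1comp.
Qed.

Definition collection : Type := slice (T terminal).

Definition tensor (x y : collection) : collection :=
  Slice (mu terminal \og Tmap (proj y) \og pb_snd (proj x) (Tmap (bang y))).

Definition tens1 (x y : collection) : gmap (tensor x y) x :=
  pb_fst (proj x) (Tmap (bang y)).

Definition tens2 (x y : collection) : gmap (tensor x y) (T y) :=
  pb_snd (proj x) (Tmap (bang y)).

Lemma tens_square (x y : collection) :
  proj x \og tens1 x y = Tmap (bang y) \og tens2 x y.
Proof. exact: pb_square. Qed.

Lemma tensor_proj (x y : collection) :
  proj (tensor x y) = mu terminal \og Tmap (proj y) \og tens2 x y.
Proof. by []. Qed.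

Definition unit_col : collection := Slice (eta terminal).

Section TensorMap.
Context (x x' y y' : collection) (f : slice_hom x x') (g : slice_hom y y').

Lemma tensor_map_subproof :
  proj x' \og (f \og tens1 x y) = Tmap (bang y') \og (Tmap g \og tens2 x y).
Proof.
rewrite !gcompA (shcomm f) tens_square -Tmap_comp.
by rewrite (bang_uniq (bang y' \og g) (bang y)).
Qed.

Definition tensor_gmap : gmap (tensor x y) (tensor x' y') :=
  pb_pair tensor_map_subproof.

Lemma tensor_map_comm : proj (tensor x' y') \og tensor_gmap = proj (tensor x y).
Proof.
rewrite !tensor_proj -(shcomm g) Tmap_comp -!gcompA.
by congr gcomp; congr gcomp; apply: gmap_ext.
Qed.

Definition tensor_map : slice_hom (tensor x y) (tensor x' y') :=
  @SliceHom _ (tensor x y) (tensor x' y') tensor_gmap tensor_map_comm.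

End TensorMap.

Section Associator.
Context (x y z : collection).

Lemma assoc1_subproof :
  proj x \og tens1 x (tensor y z) =
  Tmap (bang y) \og (Tmap (tens1 y z) \og tens2 x (tensor y z)).
Proof.
rewrite tens_square gcompA -Tmap_comp.
by rewrite (bang_uniq (bang y \og tens1 y z) (bang (tensor y z))).
Qed.

Definition assoc1 : gmap (tensor x (tensor y z)) (tensor x y) :=
  pb_pair assoc1_subproof.

Definition assoc2 : gmap (tensor x (tensor y z)) (T z) :=
  mu z \og Tmap (tens2 y z) \og tens2 x (tensor y z).

Lemma tens2_assoc1 :
  tens2 x y \og assoc1 = Tmap (tens1 y z) \og tens2 x (tensor y z).
Proof. exact: gmap_ext. Qed.

Lemma assoc_subproof :
  proj (tensor x y) \og assoc1 = Tmap (bang z) \og assoc2.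
Proof.
rewrite tensor_proj -!gcompA tens2_assoc1 /assoc2 !gcompA -mu_nat.
rewrite -!gcompA; congr gcomp; rewrite !gcompA; congr gcomp.
by rewrite -!Tmap_comp tens_square.
Qed.

Definition assoc_gmap :
  gmap (tensor x (tensor y z)) (tensor (tensor x y) z) :=
  pb_pair assoc_subproof.

Lemma assoc_comm :
  proj (tensor (tensor x y) z) \og assoc_gmap = proj (tensor x (tensor y z)).
Proof.
rewrite !tensor_proj -gcompA (_ : tens2 _ _ \og assoc_gmap = assoc2);
  last exact: gmap_ext.
rewrite /assoc2 !Tmap_comp !gcompA mu_mu -!gcompA; congr gcomp.
by rewrite !gcompA mu_nat.
Qed.

Definition associator :
  slice_hom (tensor x (tensor y z)) (tensor (tensor x y) z) :=
  @SliceHom _ (tensor x (tensor y z)) (tensor (tensor x y) z)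
    assoc_gmap assoc_comm.

End Associator.

(* The left unitor lambda_x is the unique map l with eta_x o l = pi_2; as a
   map it exists because T is cartesian, so it is used here through this
   defining equation.                                                       *)
Definition is_left_unitor (x : collection) (l : slice_hom (tensor unit_col x) x) :
  Prop := eta x \og l = tens2 unit_col x.

Lemma right_unitor_comm (x : collection) :
  proj x \og tens1 x unit_col = proj (tensor x unit_col).
Proof.
rewrite tensor_proj mu_Teta g1comp tens_square.
by rewrite (bang_uniq (bang _) (gid terminal)) Tmap_id g1comp.
Qed.

Definition right_unitor (x : collection) : slice_hom (tensor x unit_col) x :=
  @SliceHom _ (tensor x unit_col) x (tens1 x unit_col) (right_unitor_comm x).

Record operad_on (x : collection) := OperadOn {
  op_mul : slice_hom (tensor x x) x;
  op_unit : slice_hom unit_col x;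
  op_mulA : op_mul \os tensor_map (slice_id x) op_mul =
    op_mul \os tensor_map op_mul (slice_id x) \os associator x x x;
  op_mul1l : is_left_unitor (op_mul \os tensor_map op_unit (slice_id x));
  op_mul1r : op_mul \os tensor_map (slice_id x) op_unit = right_unitor x }.

Definition hom_col (b c : collection) : collection :=
  Pi (Tmap (bang b)) (pbf (Tmap (proj b)) (pbf (mu terminal) c)).

Definition Taut (x : collection) : collection := hom_col x x.

End Monad.

(* Main.v *)
Require Import Defs.
From mathcomp Require Import all_boot.
From Stdlib Require Import ProofIrrelevance ClassicalEpsilon.

(**
The collection [X,X] is the endomorphism object of X for the closed structure
of (Col, tensor, 1): its multiplication is the transpose of acting twice and
its unit is the transpose of the left unitor. Transposing requires the
associator to be invertible and the left unitor to exist, and this is where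
cartesianness of the monad T enters. Both follow from one property of T f, for
every globular map f: if T f sends a cell to a generator, an identity or a
composite, then the cell itself is, uniquely, one in a compatible way.

To see this, represent cells of T X by terms. The rules equating boundaries of
equal terms are redundant, and each remaining rule can be lifted along f, which
gives existence. For uniqueness, T X maps to the strict omega-category of trees
with nodes labelled by cells of X, the labels being subject to no condition. In
that category a composite determines its factors as soon as their shapes are
known, and a term over X is determined by its tree and its image over Y.
*)

Set Implicit Arguments.
Unset Strict Implicit.
Unset Printing Implicit Defensive.

(** * Labelled trees *)

Section LabelledTrees.
Context (Z : Type).

(* A tree of height at most [m] is an alternating sequence of labels and of trees
   of height at most [m.-1], beginning and ending with a label. *)
Fixpoint ptree m : Type :=
  match m with 0 => Z | m'.+1 => (Z * seq (ptree m' * Z))%type end.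

(* For [j <= m] this is the [j]-dimensional source ([d = false]) or target
   ([d = true]) of an [m]-cell, and for [m <= j] the iterated identity on it. *)
Fixpoint res (d : bool) m j : ptree m -> ptree j :=
  match m, j return ptree m -> ptree j with
  | 0, 0 => fun x => x
  | 0, _.+1 => fun x => (x, [::])
  | _.+1, 0 => fun a => if d then last a.1 (unzip2 a.2) else a.1
  | m'.+1, j'.+1 => fun a => (a.1, [seq (@res d m' j' u.1, u.2) | u <- a.2])
  end.

Arguments res d m j a : clear implicits.

(* Composition along dimension [j]; as in [ocomp], [a] comes after [b]. On trees
   that do not match, the value is junk. *)
Fixpoint pcomp j m : ptree m -> ptree m -> ptree m :=
  match m, j return ptree m -> ptree m -> ptree m with
  | 0, _ => fun a _ => a
  | _.+1, 0 => fun a b => (b.1, b.2 ++ a.2)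
  | m'.+1, j'.+1 => fun a b =>
      (a.1, [seq (@pcomp j' m' w.1.1 w.2.1, w.1.2) | w <- zip a.2 b.2])
  end.

Arguments pcomp j m a b : clear implicits.

Lemma res_id d m (a : ptree m) : res d m m a = a.
Proof.
elim: m a => [|m IH] //= [x l] /=; congr pair.
by elim: l => [|[u y] l IHl] //=; rewrite IH IHl.
Qed.

Lemma unzip2_res d m j (l : seq (ptree m * Z)) :
  unzip2 [seq (res d m j u.1, u.2) | u <- l] = unzip2 l.
Proof. by rewrite /unzip2 -map_comp. Qed.

(** Globularity. For [j <= m] the first restriction changes the tree only from depth [j] on, and
    restricting further to [i < j] does not look that deep, so the direction [e] is lost. *)
Lemma res_res d e i j m (a : ptree m) :
  i < j -> res d j i (res e m j a) = res d m i a.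
Proof.
elim: m i j a => [|m IH] [|i] [|j] //= a Hij; try by case: d.
  by rewrite unzip2_res.
congr pair; rewrite -map_comp; apply: eq_map => u /=; by rewrite IH.
Qed.

Lemma res_up d e i j m (a : ptree m) :
  m <= i <= j -> res d i j (res e m i a) = res d m j a.
Proof.
elim: m i j a => [|m IH] [|i] [|j] //= a Hij.
  by rewrite unzip2_res.
congr pair; rewrite -map_comp; apply: eq_map => u /=; by rewrite IH.
Qed.

(** For [i > m] this is the compatibility of composition with identities. *)
Lemma res_pcomp d i j m (a b : ptree m) : j < i -> j < m ->
  res d m i (pcomp j m a b) = pcomp j i (res d m i a) (res d m i b).
Proof.
elim: m i j a b => [|m IH] [|i] [|j] //= [x l] [y r] /= Hi Hm.
  by rewrite map_cat.
congr pair; elim: l r => [|[u p] l IHl] [|[v q] r] //=.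
by rewrite IHl IH.
Qed.

Definition pmatch j m (a b : ptree m) := res false m j a = res true m j b.

Lemma pmatch_cons j m x y u v p q (l r : seq (ptree m * Z)) :
  @pmatch j.+1 m.+1 (x, (u, p) :: l) (y, (v, q) :: r) ->
  [/\ x = y, p = q, pmatch j u v & @pmatch j.+1 m.+1 (x, l) (y, r)].
Proof. by rewrite /pmatch /= => -[-> -> -> ->]. Qed.

(** Ensures that the [zip] in [pcomp] truncates nothing when the trees match. *)
Lemma pmatch_size j m x y (l r : seq (ptree m * Z)) :
  @pmatch j.+1 m.+1 (x, l) (y, r) -> size l = size r.
Proof. by case=> _ /(congr1 size); rewrite !size_map. Qed.

Lemma res_pcomp_top d j m (a b : ptree m) : j < m -> pmatch j a b ->
  res d m j (pcomp j m a b) = if d then res d m j a else res d m j b.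
Proof.
elim: m j a b => [|m IH] [|j] //= [x l] [y r] Hm.
  by rewrite /pmatch /= => ->; case: d {IH} => //; rewrite /unzip2 map_cat last_cat.
elim: l r => [|[u p] l IHl] [|[v q] r] //=.
- by case=> ->; case: d {IH}.
move=> /pmatch_cons [E Epq Huv] /IHl; rewrite IH //.
by case: d {IH IHl} => /= [[->]|[_ ->]]; rewrite ?E ?Epq.
Qed.

(** Holds for all trees: concatenation is associative, and truncation by [zip] is the same for both
    bracketings. *)
Lemma pcompA j m (a b c : ptree m) :
  pcomp j m (pcomp j m a b) c = pcomp j m a (pcomp j m b c).
Proof.
elim: m j a b c => [|m IH] [|j] //= [x l] [y r] [z s] /=; first by rewrite catA.
congr pair; elim: l r s => [|[u p] l IHl] [|[v q] r] [|[w o] s] //=.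
by rewrite IH IHl.
Qed.

Lemma pcomp_idl j m (a : ptree m) : j < m ->
  pcomp j m (res false j m (res true m j a)) a = a.
Proof.
elim: m j a => [|m IH] [|j] //= [x l] Hj /=; first by rewrite cats0.
by congr pair; elim: l => [|[u p] l IHl] //=; rewrite IH // IHl.
Qed.

Lemma pcomp_idr j m (a : ptree m) : j < m ->
  pcomp j m a (res false j m (res false m j a)) = a.
Proof.
elim: m j a => [|m IH] [|j] //= [x l] Hj /=; first by [].
by congr pair; elim: l => [|[u p] l IHl] //=; rewrite IH // IHl.
Qed.

(** At depth [i] one composition concatenates and the other zips. They commute because matching
    sequences have equal length. *)
Lemma pcomp_inter i j m (a b a' b' : ptree m) : i < j < m ->
  pmatch j a b -> pmatch j a' b' ->
  pcomp i m (pcomp j m a b) (pcomp j m a' b') =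
  pcomp j m (pcomp i m a a') (pcomp i m b b').
Proof.
elim: m i j a b a' b' => [|m IH] [|i] [|j] //= [x l] [y r] [x' l'] [y' r'] Hij.
  by move=> _ /pmatch_size H' /=; rewrite -map_cat zip_cat.
move=> H H' /=; congr pair.
elim: l r l' r' H H' => [|[u p] l IHl] [|[v q] r] [|[u' p'] l'] [|[v' q'] r'] //=;
  try by [move/pmatch_size | move=> _ /pmatch_size].
move=> /pmatch_cons [_ _ Huv H] /pmatch_cons [_ _ Huv' H'] /=.
by rewrite IH // IHl.
Qed.

Definition ptree_glob : globset.
Proof.
exists ptree (fun n => res false n.+1 n) (fun n => res true n.+1 n) => n x;
  by rewrite !res_res.
Defined.

Lemma isrc_res k n (p : lt_dim k n) (a : ptree_glob n) :
  isrc p a = res false n k a.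
Proof.
elim: p a => [|m q IH] a //=.
by rewrite IH; apply: res_res; apply: (ltd_ltn q).
Qed.

Lemma itgt_res k n (p : lt_dim k n) (a : ptree_glob n) :
  itgt p a = res true n k a.
Proof.
elim: p a => [|m q IH] a //=.
by rewrite IH; apply: res_res; apply: (ltd_ltn q).
Qed.

Lemma iid_res k n (p : lt_dim k n) (a : ptree_glob k) :
  iid (fun m => res false m m.+1 : ptree_glob m -> ptree_glob m.+1) p a =
  res false k n a.
Proof.
by elim: p => [|m q IH] //=; rewrite IH res_up // (ltnW (ltd_ltn q)) leqnSn.
Qed.

Lemma isrc_itgt_match k n (p : lt_dim k n) (a b : ptree_glob n) :
  isrc p a = itgt p b -> pmatch k a b.
Proof. by rewrite isrc_res itgt_res. Qed.

(** Identities are taken as [res false]; when the dimension goes up, [res] does not depend on the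
    direction. *)
Definition ptree_ocat : ocat.
Proof.
apply: (@OCat ptree_glob (fun n => res false n n.+1)
  (fun k n (p : lt_dim k n) a b _ => pcomp k n a b)).
- by move=> n a; rewrite [LHS]res_res // res_id.
- by move=> n a; rewrite [LHS]res_res // res_id.
- move=> n a b H; exact: (res_pcomp_top false _ (isrc_itgt_match H)).
- move=> n a b H; exact: (res_pcomp_top true _ (isrc_itgt_match H)).
- by move=> k n p a b _ _; apply: res_pcomp; rewrite ?leqW // (ltd_ltn p).
- by move=> k n p a b _ _; apply: res_pcomp; rewrite ?leqW // (ltd_ltn p).
- by move=> k n p a b c _ _ _ _; apply: pcompA.
- by move=> k n p a _; rewrite iid_res itgt_res pcomp_idl // ltd_ltn.
- by move=> k n p a _; rewrite iid_res isrc_res pcomp_idr // ltd_ltn.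
- by move=> k n p a b _ _; apply: res_pcomp; rewrite ?leqW // (ltd_ltn p).
move=> j k n p q r a b a' b' Hab Hab' _ _ _ _.
apply: pcomp_inter; first by rewrite !ltd_ltn.
  exact: (isrc_itgt_match Hab).
exact: (isrc_itgt_match Hab').
Defined.

End LabelledTrees.

Arguments res {Z} d m j a.
Arguments pcomp {Z} j m a b.

(** * Relabelling of trees and unique factorisation *)

Section TreeMap.
Context (Z Z' : Type) (h : Z -> Z').

Fixpoint pmap m : ptree Z m -> ptree Z' m :=
  match m return ptree Z m -> ptree Z' m with
  | 0 => h
  | m'.+1 => fun a => (h a.1, [seq (@pmap m' u.1, h u.2) | u <- a.2])
  end.

Arguments pmap m a : clear implicits.

Lemma pmap_res d m j (a : ptree Z m) : pmap j (res d m j a) = res d m j (pmap m a).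
Proof.
elim: m j a => [|m IH] [|j] //= [x l] /=.
  by case: d {IH} => //; rewrite /unzip2 -map_comp -(last_map h) -map_comp.
by congr pair; elim: l => [|[u p] l IHl] //=; rewrite IH IHl.
Qed.

Lemma pmap_pcomp j m (a b : ptree Z m) :
  pmap m (pcomp j m a b) = pcomp j m (pmap m a) (pmap m b).
Proof.
elim: m j a b => [|m IH] [|j] //= [x l] [y r] /=; first by rewrite map_cat.
by congr pair; elim: l r => [|[u p] l IHl] [|[v q] r] //=; rewrite IH IHl.
Qed.

(** At depth [j] a composite is a concatenation, and the shape given by [pmap] says where to cut it.
    The labels of one factor that [pcomp] drops are recovered from the other by matching. *)
Lemma pcomp_inj j m (a b a' b' : ptree Z m) : j < m ->
  pmatch j a b -> pmatch j a' b' ->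
  pmap m a = pmap m a' -> pmap m b = pmap m b' ->
  pcomp j m a b = pcomp j m a' b' -> a = a' /\ b = b'.
Proof.
elim: m j a b a' b' => [|m IH] [|j] //= [x l] [y r] [x' l'] [y' r'] Hj.
  rewrite /pmatch /= => -> -> _ [_ /(congr1 size)]; rewrite !size_map => Es [-> E].
  have Er : r = r' by rewrite -(take_size_cat l Es) E take_size_cat.
  by rewrite Er -(drop_size_cat l Es) E drop_size_cat.
move=> H H' [_ El] [_ Er] /= [Ex].
have [[Exy _] [Exy' _]] := (H, H'); move: Exy Exy' => /= Exy Exy'.
suff E : [seq (pcomp j m w.1.1 w.2.1, w.1.2) | w <- zip l r] =
    [seq (pcomp j m w.1.1 w.2.1, w.1.2) | w <- zip l' r'] -> l = l' /\ r = r'.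
  by move=> /E [-> ->]; rewrite -Exy -Exy' Ex.
move: H H' El Er {Ex Exy Exy'}.
elim: l r l' r' => [|[u p] l IHl] [|[v q] r] [|[u' p'] l'] [|[v' q'] r'] //=;
  try by [move/pmatch_size | move=> _ /pmatch_size].
move=> /(@pmatch_cons Z j m) [_ <- Huv H] /(@pmatch_cons Z j m) [_ <- Huv' H'].
move=> [Eu _ El] [Ev _ Er] [E -> /(IHl _ _ _ H H' El Er) [-> ->]].
by have [-> ->] := IH _ _ _ _ _ Hj Huv Huv' Eu Ev E.
Qed.

End TreeMap.

Arguments pmap {Z Z'} h m a.

(** * Equality of terms without boundary rules *)

Import FreeExistence.

Section BoundaryFreeEquality.
Context (X : globset).

(* [teq] without [te_bd] and [te_glob], the two rules that cannot be lifted along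
   a map of globular sets: a cell over [src y] need not be the source of a cell
   over [y]. *)
Inductive ceq : forall n, tm X n -> tm X n -> Prop :=
  | ce_sym n (a b : tm X n) : ceq a b -> ceq b a
  | ce_trans n (a b c : tm X n) : ceq a b -> ceq b c -> ceq a c
  | ce_gen n (x : X n) : ceq (tgen x) (tgen x)
  | ce_id n (a a' : tm X n) : ceq a a' -> ceq (tid a) (tid a')
  | ce_comp k n (p : lt_dim k n) (a a' b b' : tm X n) :
      ceq a a' -> ceq b b' -> teq (tibd false p a) (tibd true p b) ->
      ceq (tcomp p a b) (tcomp p a' b')
  | ce_assoc k n (p : lt_dim k n) (a b c : tm X n) :
      teq (tcomp p (tcomp p a b) c) (tcomp p (tcomp p a b) c) ->
      teq (tcomp p a (tcomp p b c)) (tcomp p a (tcomp p b c)) ->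
      ceq (tcomp p (tcomp p a b) c) (tcomp p a (tcomp p b c))
  | ce_idl k n (p : lt_dim k n) (a : tm X n) : teq a a ->
      ceq (tcomp p (tiid p (tibd true p a)) a) a
  | ce_idr k n (p : lt_dim k n) (a : tm X n) : teq a a ->
      ceq (tcomp p a (tiid p (tibd false p a))) a
  | ce_idcomp k n (p : lt_dim k n) (a b : tm X n) :
      teq (tid (tcomp p a b)) (tid (tcomp p a b)) ->
      ceq (tid (tcomp p a b)) (tcomp (ltd_up p) (tid a) (tid b))
  | ce_inter j k n (p : lt_dim j k) (q : lt_dim k n) (r : lt_dim j n)
      (a b a' b' : tm X n) :
      teq (tcomp r (tcomp q a b) (tcomp q a' b'))
          (tcomp r (tcomp q a b) (tcomp q a' b')) ->
      teq (tcomp q (tcomp r a a') (tcomp r b b'))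
          (tcomp q (tcomp r a a') (tcomp r b b')) ->
      ceq (tcomp r (tcomp q a b) (tcomp q a' b'))
          (tcomp q (tcomp r a a') (tcomp r b b')).

(* [ceq] together with its closure under the two omitted rules in all lower
   dimensions; this is what an induction on [teq] can carry along. *)
Fixpoint hceq n : tm X n -> tm X n -> Prop :=
  match n return tm X n -> tm X n -> Prop with
  | 0 => fun a b => teq a b /\ ceq a b
  | m.+1 => fun a b =>
      let glob := match m return tm X m.+1 -> Prop with
        | 0 => fun _ => True
        | i.+1 => fun c =>
            forall d, @hceq i (tbd d (tbd false c)) (tbd d (tbd true c))
        end in
      [/\ teq a b, ceq a b, forall d, @hceq m (tbd d a) (tbd d b), glob a & glob b]
  end.

(** The local condition [glob] of [hceq] under a name, convertible with it: globularity of a single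
    term. *)
Definition hglob n : tm X n.+1 -> Prop :=
  match n return tm X n.+1 -> Prop with
  | 0 => fun _ => True
  | i.+1 => fun c => forall d, hceq (tbd d (tbd false c)) (tbd d (tbd true c))
  end.

Lemma hceqI n (a b : tm X n.+1) : teq a b -> ceq a b ->
  (forall d, hceq (tbd d a) (tbd d b)) -> hglob a -> hglob b -> hceq a b.
Proof. by move=> *; split. Qed.

Lemma hceqE n (a b : tm X n.+1) : hceq a b ->
  [/\ teq a b, ceq a b, forall d, hceq (tbd d a) (tbd d b), hglob a & hglob b].
Proof. by []. Qed.

Lemma hceq_teq n (a b : tm X n) : hceq a b -> teq a b.
Proof. by case: n a b => [|n] a b []. Qed.

Lemma hceq_ceq n (a b : tm X n) : hceq a b -> ceq a b.
Proof. by case: n a b => [|n] a b []. Qed.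

Lemma hceq_bd d n (a b : tm X n.+1) : hceq a b -> hceq (tbd d a) (tbd d b).
Proof. by case/hceqE. Qed.

Lemma hceq_hglob n (a b : tm X n.+1) : hceq a b -> hglob a /\ hglob b.
Proof. by case/hceqE. Qed.

Lemma hceq_sym n (a b : tm X n) : hceq a b -> hceq b a.
Proof.
elim: n a b => [|n IH] a b.
  by case=> /te_sym Hab /ce_sym Cab.
case/hceqE=> /te_sym Hab /ce_sym Cab D Ga Gb.
by apply: hceqI => // d; apply/IH/D.
Qed.

Lemma hceq_trans n (a b c : tm X n) : hceq a b -> hceq b c -> hceq a c.
Proof.
elim: n a b c => [|n IH] a b c.
  by case=> Hab Cab [Hbc Cbc]; split; [apply: te_trans Hbc | apply: ce_trans Cbc].
case/hceqE=> Hab Cab Dab Ga _ /hceqE [Hbc Cbc Dbc _ Gc].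
apply: hceqI => // [||d]; [exact: te_trans Hbc | exact: ce_trans Cbc |].
exact: IH (Dab d) (Dbc d).
Qed.

Lemma hceq_reflL n (a b : tm X n) : hceq a b -> hceq a a.
Proof. by move=> H; apply: hceq_trans H (hceq_sym H). Qed.

Lemma hceq_ibd d k n (p : lt_dim k n) (a b : tm X n) :
  hceq a b -> hceq (tibd d p a) (tibd d p b).
Proof. by elim: p a b => [|m q IH] a b H /=; [|apply: IH]; apply: hceq_bd. Qed.

Lemma hceq_iglob d k n (p : lt_dim k n) (a : tm X n.+1) : hceq a a ->
  hceq (tibd d p (tbd false a)) (tibd d p (tbd true a)).
Proof.
by case: p a => [|m q] a /hceq_hglob [G _]; [apply: G | apply: hceq_ibd (G d)].
Qed.

(** Strong induction on the dimension, since [hglob] looks two dimensions down. *)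
Lemma hceq_gen n (x : X n) : hceq (tgen x) (tgen x).
Proof.
suff H m : forall n (y : X n), n <= m -> hceq (tgen y) (tgen y) by apply: (H n).
elim: m => [|m IH] {n x} [|n] x Hn //;
  try by split; [apply: te_gen | apply: ce_gen].
have G : hglob (tgen x).
  case: n x Hn => [|n] x Hn //= d; rewrite src_glob tgt_glob.
  by apply: IH; apply: ltnW.
apply: hceqI => //; [exact: te_gen | exact: ce_gen | move=> d; exact: IH].
Qed.

Lemma hceq_id n (a a' : tm X n) : hceq a a' -> hceq (tid a) (tid a').
Proof.
move=> H; apply: hceqI => //.
- exact: te_id (hceq_teq H).
- exact: ce_id (hceq_ceq H).
- by case: n a a' H => [|n] a a' H //= d; apply: hceq_bd (hceq_reflL H).
by case: n a a' H => [|n] a a' /hceq_sym H //= d; apply: hceq_bd (hceq_reflL H).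
Qed.

Lemma hceq_iid k n (p : lt_dim k n) (a a' : tm X k) :
  hceq a a' -> hceq (tiid p a) (tiid p a').
Proof. by move=> H; elim: p => [|m q IH] /=; apply: hceq_id. Qed.

(** Strong induction on the dimension: the iterated boundaries of a composite are composites of
    boundaries until dimension [k] is reached, where they become boundaries of one factor. *)
Lemma hceq_comp k n (p : lt_dim k n) (a a' b b' : tm X n) :
  hceq a a' -> hceq b b' -> hceq (tibd false p a) (tibd true p b) ->
  hceq (tcomp p a b) (tcomp p a' b').
Proof.
suff H N : forall n (p : lt_dim k n) (a a' b b' : tm X n), n <= N ->
    hceq a a' -> hceq b b' -> hceq (tibd false p a) (tibd true p b) ->
    hceq (tcomp p a b) (tcomp p a' b') by apply: (H n).
elim: N => [|N IH] {p a a' b b'}{}n p a a' b b' Hn Ha Hb Hab.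
  by have := leq_trans (ltd_ltn p) Hn.
(* Composability descends to boundaries: one of the two sides already has the direction found in the
   hypothesis, and globularity turns the other. *)
have C d n0 (q : lt_dim k n0) (u v : tm X n0.+1) : hceq u u -> hceq v v ->
    hceq (tibd false (ltd_up q) u) (tibd true (ltd_up q) v) ->
    hceq (tibd false q (tbd d u)) (tibd true q (tbd d v)).
  move=> Hu Hv H; case: d.
    by apply: hceq_trans H; apply/hceq_sym/hceq_iglob.
  by apply: hceq_trans H _; apply/hceq_sym/hceq_iglob.
(* Globularity of the composite. In codimension one the chain passes through the common boundary
   [Hab], in codimension two it is globularity of one factor, and beyond that it compares composites
   two dimensions down. *)
have G : forall a b : tm X n, hceq a a -> hceq b b ->
    hceq (tibd false p a) (tibd true p b) ->
    match n return tm X n -> Prop with 0 => fun _ => True | _.+1 => @hglob _ end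
      (tcomp p a b).
  move=> {a' b' Ha Hb Hab}{}a {}b Ha Hb Hab.
  case: p a b Hn Ha Hb Hab => [|n' q] a b Hn Ha Hb Hab.
    case: k {C IH} a b Hn Ha Hb Hab => [|k] a b Hn Ha Hb Hab //= d.
    have [Ga _] := hceq_hglob Ha; have [Gb _] := hceq_hglob Hb.
    apply: hceq_trans (Gb d) _; apply: hceq_trans _ (Ga d).
    by apply/hceq_sym; apply: hceq_bd Hab.
  case: q a b Hn Ha Hb Hab => [|n'' q] a b Hn Ha Hb Hab d.
    have [Ga _] := hceq_hglob Ha; have [Gb _] := hceq_hglob Hb.
    by case: d; [apply: Ga | apply: Gb].
  have [Ga _] := hceq_hglob Ha; have [Gb _] := hceq_hglob Hb.
  apply: IH; [by apply: ltnW | exact: Ga | exact: Gb |].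
  apply: (C d); try by apply: hceq_bd.
  by apply: (C false).
have Hab' : hceq (tibd false p a') (tibd true p b').
  apply: hceq_trans (hceq_ibd false p (hceq_sym Ha)) _.
  exact: hceq_trans Hab (hceq_ibd true p Hb).
have [Ra Rb] := (hceq_reflL Ha, hceq_reflL Hb).
have [Ra' Rb'] := (hceq_reflL (hceq_sym Ha), hceq_reflL (hceq_sym Hb)).
move: (G a b Ra Rb Hab) (G a' b' Ra' Rb' Hab') => {G}.
have T1 : teq (tcomp p a b) (tcomp p a' b') by apply: te_comp; apply: hceq_teq.
have T2 : ceq (tcomp p a b) (tcomp p a' b').
  by apply: ce_comp; [apply: hceq_ceq | apply: hceq_ceq | apply: hceq_teq].
case: p a a' b b' Hn Ha Hb Hab Ra Rb T1 T2 {Ra' Rb' Hab'}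
  => [|m q] a a' b b' Hn Ha Hb Hab Ra Rb T1 T2 G G'.
  by apply: hceqI => // -[]; [exact: (hceq_bd true Ha) | exact: (hceq_bd false Hb)].
apply: hceqI => // d; apply: IH => //; try exact: hceq_bd.
exact: C.
Qed.

(** Well-formedness of both sides supplies globularity, so for an axiom only boundaries remain to be
    compared. In codimension one these agree by computation; above it they are, up to globularity,
    the same axiom one dimension down. *)
Lemma hceq_axiom n (a b : tm X n.+1) : hceq a a -> hceq b b ->
  teq a b -> ceq a b -> (forall d, hceq (tbd d a) (tbd d b)) -> hceq a b.
Proof. by move=> /hceq_hglob [Ga _] /hceq_hglob [Gb _] *; apply: hceqI. Qed.

Lemma hceq_assoc k n (p : lt_dim k n) (a b c : tm X n) :
  hceq (tcomp p (tcomp p a b) c) (tcomp p (tcomp p a b) c) ->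
  hceq (tcomp p a (tcomp p b c)) (tcomp p a (tcomp p b c)) ->
  hceq (tcomp p (tcomp p a b) c) (tcomp p a (tcomp p b c)).
Proof.
elim: p a b c => [|m q IH] a b c H H'; apply: (hceq_axiom H H');
  try by [apply: te_assoc; apply: hceq_teq | apply: ce_assoc; apply: hceq_teq].
  by case; [have := hceq_bd true H | have := hceq_bd false H].
by move=> d; apply: IH; [have := hceq_bd d H | have := hceq_bd d H'].
Qed.

Lemma tibd_tiid d k n (p : lt_dim k n) (a : tm X k) : tibd d p (tiid p a) = a.
Proof. by elim: p => [|m q IH] /=. Qed.

Lemma hceq_idl k n (p : lt_dim k n) (a : tm X n) : hceq a a ->
  hceq (tcomp p (tiid p (tibd true p a)) a) a.
Proof.
move=> H; have H' : hceq (tcomp p (tiid p (tibd true p a)) a)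
    (tcomp p (tiid p (tibd true p a)) a).
  apply: hceq_comp => //; first by apply/hceq_iid/hceq_ibd.
  by rewrite tibd_tiid; apply: hceq_ibd.
elim: p a H H' => [|m q IH] a H H'; apply: (hceq_axiom H' H);
  try by [apply: te_idl; apply: hceq_teq | apply: ce_idl; apply: hceq_teq].
  by case; [exact: (hceq_bd true H) | exact: (hceq_bd false H)].
case; first by apply: IH; [apply: hceq_bd | have := hceq_bd true H'].
(* The source of the identity is built from [tbd true a], whereas the law one dimension down needs
   [tbd false a]; globularity exchanges them. *)
have Hf := hceq_bd false H; have Hg := hceq_iglob true q H.
apply: (@hceq_trans _ _ (tcomp q (tiid q (tibd true q (tbd false a))) (tbd false a))).
  apply: hceq_comp => //; first exact/hceq_iid/hceq_sym.
  by rewrite tibd_tiid; apply: hceq_sym.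
apply: IH => //; apply: hceq_comp => //; first exact/hceq_iid/hceq_ibd.
by rewrite tibd_tiid; apply: hceq_ibd.
Qed.

Lemma hceq_idr k n (p : lt_dim k n) (a : tm X n) : hceq a a ->
  hceq (tcomp p a (tiid p (tibd false p a))) a.
Proof.
move=> H; have H' : hceq (tcomp p a (tiid p (tibd false p a)))
    (tcomp p a (tiid p (tibd false p a))).
  apply: hceq_comp => //; first by apply/hceq_iid/hceq_ibd.
  by rewrite tibd_tiid; apply: hceq_ibd.
elim: p a H H' => [|m q IH] a H H'; apply: (hceq_axiom H' H);
  try by [apply: te_idr; apply: hceq_teq | apply: ce_idr; apply: hceq_teq].
  by case; [exact: (hceq_bd true H) | exact: (hceq_bd false H)].
case; last by apply: IH; [apply: hceq_bd | have := hceq_bd false H'].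
have Hf := hceq_bd true H; have Hg := hceq_iglob false q H.
apply: (@hceq_trans _ _ (tcomp q (tbd true a) (tiid q (tibd false q (tbd true a))))).
  apply: hceq_comp => //; first exact/hceq_iid.
  by rewrite tibd_tiid; apply: hceq_sym.
apply: IH => //; apply: hceq_comp => //; first exact/hceq_iid/hceq_ibd.
by rewrite tibd_tiid; apply: hceq_ibd.
Qed.

Lemma hceq_inter j k n (p : lt_dim j k) (q : lt_dim k n) (r : lt_dim j n)
    (a b a' b' : tm X n) :
  hceq (tcomp r (tcomp q a b) (tcomp q a' b'))
       (tcomp r (tcomp q a b) (tcomp q a' b')) ->
  hceq (tcomp q (tcomp r a a') (tcomp r b b'))
       (tcomp q (tcomp r a a') (tcomp r b b')) ->
  hceq (tcomp r (tcomp q a b) (tcomp q a' b'))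
       (tcomp q (tcomp r a a') (tcomp r b b')).
Proof.
elim: q r a b a' b' => [|m q IH] r a b a' b'.
  (* [r] is put in constructor form so that [tbd] computes on composites along it. *)
  rewrite (lt_dim_irr r (ltd_up p)) => H H'; apply: (hceq_axiom H H');
    try by [apply: (te_inter p); apply: hceq_teq | apply: (ce_inter p); apply: hceq_teq].
  by case; [have := hceq_bd true H | have := hceq_bd false H].
have ltd_trans i (s : lt_dim k i) : lt_dim j i.
  by elim: s => [|i' _ IHs]; apply: ltd_up.
rewrite (lt_dim_irr r (ltd_up (ltd_trans _ q))) => H H'; apply: (hceq_axiom H H');
  try by [apply: (te_inter p); apply: hceq_teq | apply: (ce_inter p); apply: hceq_teq].
by move=> d; apply: IH; [have := hceq_bd d H | have := hceq_bd d H'].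
Qed.

Lemma hceq_idcomp k n (p : lt_dim k n) (a b : tm X n) :
  hceq (tid (tcomp p a b)) (tid (tcomp p a b)) ->
  hceq (tcomp (ltd_up p) (tid a) (tid b)) (tcomp (ltd_up p) (tid a) (tid b)) ->
  hceq (tid (tcomp p a b)) (tcomp (ltd_up p) (tid a) (tid b)).
Proof.
move=> H H'; apply: (hceq_axiom H H').
- by apply: te_idcomp; apply: hceq_teq.
- by apply: ce_idcomp; apply: hceq_teq.
by move=> d; have := hceq_bd d H.
Qed.

(** The two boundary rules are read off the components of [hceq]; closure under every other rule has
    been proved separately. *)
Lemma teq_hceq n (a b : tm X n) : teq a b -> hceq a b.
Proof.
elim=> {n a b}.
- by move=> n a b _; apply: hceq_sym.
- by move=> n a b c _ H _; apply: hceq_trans H.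
- by move=> n x; apply: hceq_gen.
- by move=> n a a' _; apply: hceq_id.
- by move=> k n p a a' b b' _ Ha _ Hb _; apply: hceq_comp.
- by move=> d n a a' _; apply: hceq_bd.
- by move=> d n a _ /hceq_hglob [].
- by move=> k n p a b c _ H _; apply: hceq_assoc.
- by move=> k n p a _ H _ _; apply: hceq_idl.
- by move=> k n p a _ H _ _; apply: hceq_idr.
- by move=> k n p a b _ H _; apply: hceq_idcomp.
by move=> j k n p q r a b a' b' _ H _; apply: hceq_inter.
Qed.

Lemma teq_ceq n (a b : tm X n) : teq a b -> ceq a b.
Proof. by move/teq_hceq/hceq_ceq. Qed.

End BoundaryFreeEquality.

(** * Lifting of terms *)

(* The shape of the globe of dimension [m]: [z] labels its top cell, and
   [g d i] its [i]-dimensional source or target, counting from dimension [k]. *)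
Fixpoint linear (Z : Type) (g : bool -> nat -> Z) (z : Z) m k : ptree Z m :=
  match m with
  | 0 => z
  | m'.+1 => (g false k, [:: (linear g z m' k.+1, g true k)])
  end.

Arguments linear {Z} g z m k.

Section Linear.
Context (Z Z' : Type).

Lemma res_linear d (g : bool -> nat -> Z) z m k :
  res d m.+1 m (linear g z m.+1 k) = linear g (g d (k + m)) m k.
Proof.
elim: m k => [|m IH] k; first by rewrite addn0; case: d.
have -> : res d m.+2 m.+1 (linear g z m.+2 k) =
  (g false k, [:: (res d m.+1 m (linear g z m.+1 k.+1), g true k)]) by [].
by rewrite IH addSnnS.
Qed.

Lemma eq_linear (g g' : bool -> nat -> Z) z m k :
  (forall d i, i < k + m -> g d i = g' d i) ->
  linear g z m k = linear g' z m k.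
Proof.
elim: m k => [|m IH] k //= Eg.
by rewrite !Eg ?IH ?addnS ?ltnS ?leq_addr // => d i Hi; apply: Eg; rewrite addnS.
Qed.

Lemma linear_inj (g g' : bool -> nat -> Z) z z' m k :
  linear g z m k = linear g' z' m k -> z = z'.
Proof. by elim: m k => [|m IH] k //= [_ /IH]. Qed.

Lemma pmap_linear (h : Z -> Z') (g : bool -> nat -> Z) z m k :
  pmap h m (linear g z m k) = linear (fun d i => h (g d i)) (h z) m k.
Proof. by elim: m k => [|m IH] k //=; rewrite IH. Qed.

End Linear.

(** * Cells as trees labelled by their boundaries *)

Section Labels.
Context (X : globset).

(** The sum over all dimensions, because a single tree carries cells of different dimensions. *)
Definition label := {n : nat & X n}.

Definition lab n (x : X n) : label := existT _ n x.

Lemma lab_inj n (x y : X n) : lab x = lab y -> x = y.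
Proof. exact: inj_pair2. Qed.

(** The label of the [i]-dimensional source or target of [x]. The default [lab x] for [i >= n]
    matters at [i = n], where a boundary of a larger cell has to label its own top position in
    [res_lin]. *)
Fixpoint bd_lab (d : bool) n : X n -> nat -> label :=
  match n return X n -> nat -> label with
  | 0 => fun x _ => lab x
  | m.+1 => fun x i =>
      if i <= m then @bd_lab d m (if d then tgt x else src x) i else lab x
  end.

Arguments bd_lab d {n} x i.

Lemma bd_lab_top d n (x : X n) : bd_lab d x n = lab x.
Proof. by case: n x => [|n] x //=; rewrite ltnn. Qed.

Lemma bd_lab_bd d e n (x : X n.+1) i : i < n ->
  bd_lab d (if e then tgt x else src x) i = bd_lab d x i.
Proof.
case: n x => [|n] x // Hi /=; rewrite (ltnW Hi) -ltnS Hi.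
by case: d; case: e; rewrite ?src_glob ?tgt_glob.
Qed.

Definition lin n (x : X n) : ptree label n := linear (fun d => bd_lab d x) (lab x) n 0.

Lemma res_lin (d : bool) n (x : X n.+1) :
  res d n.+1 n (lin x) = lin (if d then tgt x else src x).
Proof.
rewrite /lin res_linear add0n /= leqnn bd_lab_top.
apply: eq_linear => e i; rewrite add0n => Hi.
by rewrite [RHS]bd_lab_bd.
Qed.

Definition lin_gmap : gmap X (ptree_ocat label) :=
  @GMap X (ptree_ocat label) lin
    (fun n x => esym (res_lin false x)) (fun n x => esym (res_lin true x)).

Lemma lin_inj n (x y : X n) : lin x = lin y -> x = y.
Proof. by move=> E; apply: lab_inj; apply: linear_inj E. Qed.

End Labels.

Definition label_map (X Y : globset) (f : gmap X Y) (l : label X) : label Y :=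
  lab (f _ (projT2 l)).

Lemma pmap_lin (X Y : globset) (f : gmap X Y) n (x : X n) :
  pmap (label_map f) n (lin x) = lin (f n x).
Proof.
rewrite /lin pmap_linear; apply: eq_linear => d i _.
elim: n x => [|n IH] x //=; case: ifP => // _.
by rewrite IH; case: d {IH}; rewrite ?gfun_src ?gfun_tgt.
Qed.

(** * Boundaries, well-formedness and trees of terms *)

Section TermBoundaries.
Context (X : globset).

(** Self-equality serves as well-formedness. As transitivity prevents a direct inversion of [teq],
    the proof goes through [wf]. *)
Lemma te_comp_inv k n (p : lt_dim k n) (a b : tm X n) :
  teq (tcomp p a b) (tcomp p a b) ->
  [/\ teq a a, teq b b & teq (tibd false p a) (tibd true p b)].
Proof. by move/teq_wf => [[]]. Qed.

Lemma te_id_inv n (a : tm X n) : teq (tid a) (tid a) -> teq a a.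
Proof. by move/teq_wf => [[]]. Qed.

Lemma te_compI k n (p : lt_dim k n) (a b : tm X n) :
  teq a a -> teq b b -> teq (tibd false p a) (tibd true p b) ->
  teq (tcomp p a b) (tcomp p a b).
Proof. exact: te_comp. Qed.

Lemma tibd_comp d k n (p : lt_dim k n) (a b : tm X n) :
  tibd d p (tcomp p a b) = if d then tibd d p a else tibd d p b.
Proof. by elim: p a b => [|m q IH] a b //=; rewrite IH. Qed.

Lemma te_iglob2 d e e' k n (p : lt_dim k n) (a : tm X n.+1) : teq a a ->
  teq (tibd d p (tbd e a)) (tibd d p (tbd e' a)).
Proof.
move=> Ha; case: e; case: e'; try by [apply: te_iglob | apply/te_sym/te_iglob];
  by apply/te_ibd/te_bd.
Qed.

Fixpoint ltd_trans j k n (p : lt_dim j k) (q : lt_dim k n) : lt_dim j n :=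
  match q in lt_dim _ m return lt_dim j m with
  | ltd_S => ltd_up p
  | ltd_up _ q' => ltd_up (ltd_trans p q')
  end.

Lemma te_ibd_ibd d e j k n (p : lt_dim j k) (q : lt_dim k n) (r : lt_dim j n)
    (a : tm X n) :
  teq a a -> teq (tibd d p (tibd e q a)) (tibd d r a).
Proof.
rewrite (lt_dim_irr r (ltd_trans p q)) {r}.
elim: q a => [|m q IH] a Ha /=; first exact: te_iglob2.
by apply: te_trans (IH _ (te_bd e Ha)) _; apply: te_iglob2.
Qed.

Lemma tibd_comp_low d j k n (p : lt_dim j k) (q : lt_dim k n) (r : lt_dim j n)
    (a b : tm X n) :
  tibd d r (tcomp q a b) = if d then tibd d r a else tibd d r b.
Proof.
rewrite (lt_dim_irr r (ltd_trans p q)) {r}.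
elim: q a b => [|m q IH] a b /=; first by case: d.
by rewrite IH.
Qed.

Lemma tibd_comp_high d j k n (p : lt_dim j k) (q : lt_dim k n) (r : lt_dim j n)
    (a b : tm X n) :
  tibd d q (tcomp r a b) = tcomp p (tibd d q a) (tibd d q b).
Proof.
rewrite (lt_dim_irr r (ltd_trans p q)) {r}.
by elim: q a b => [|m q IH] a b //=.
Qed.

Lemma te_idlI k n (p : lt_dim k n) (a : tm X n) : teq a a ->
  teq (tcomp p (tiid p (tibd true p a)) a) a.
Proof.
move=> Ha; apply: te_idl => //; apply: te_compI => //.
  exact/te_iid/te_ibd.
by rewrite tibd_tiid; apply: te_ibd.
Qed.

Lemma te_idrI k n (p : lt_dim k n) (a : tm X n) : teq a a ->
  teq (tcomp p a (tiid p (tibd false p a))) a.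
Proof.
move=> Ha; apply: te_idr => //; apply: te_compI => //.
  exact/te_iid/te_ibd.
by rewrite tibd_tiid; apply: te_ibd.
Qed.

(* In the other direction, [te_inter_inv], the composability of [a] with [b] and
   of [a'] with [b'] has to be assumed. *)
Lemma te_inter_wf j k n (p : lt_dim j k) (q : lt_dim k n) (r : lt_dim j n)
    (a b a' b' : tm X n) :
  teq (tcomp r (tcomp q a b) (tcomp q a' b'))
      (tcomp r (tcomp q a b) (tcomp q a' b')) ->
  teq (tcomp q (tcomp r a a') (tcomp r b b'))
      (tcomp q (tcomp r a a') (tcomp r b b')).
Proof.
case/te_comp_inv=> /te_comp_inv [Ha Hb Hab] /te_comp_inv [Ha' Hb' Hab'].
rewrite !(tibd_comp_low _ p) => H.
have Haa : teq (tibd false r a) (tibd true r a').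
  apply: te_trans (te_sym (te_ibd_ibd false false p q r Ha)) _.
  apply: te_trans (te_ibd false p Hab) _.
  by apply: te_trans H; apply: te_ibd_ibd.
have Hbb : teq (tibd false r b) (tibd true r b').
  apply: te_trans H _.
  apply: te_trans (te_sym (te_ibd_ibd true false p q r Ha')) _.
  apply: te_trans (te_ibd true p Hab') _.
  exact: te_ibd_ibd.
apply: te_compI; try exact: te_compI.
rewrite !(tibd_comp_high _ p); apply: te_comp => //.
apply: te_trans (te_ibd_ibd _ _ _ _ r Ha) _; apply: te_trans Haa _.
exact/te_sym/te_ibd_ibd.
Qed.

Lemma te_inter_inv j k n (p : lt_dim j k) (q : lt_dim k n) (r : lt_dim j n)
    (a b a' b' : tm X n) :
  teq (tcomp q (tcomp r a a') (tcomp r b b'))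
      (tcomp q (tcomp r a a') (tcomp r b b')) ->
  teq (tibd false q a) (tibd true q b) ->
  teq (tibd false q a') (tibd true q b') ->
  teq (tcomp r (tcomp q a b) (tcomp q a' b'))
      (tcomp r (tcomp q a b) (tcomp q a' b')).
Proof.
case/te_comp_inv=> /te_comp_inv [Ha Ha' Haa] /te_comp_inv [Hb Hb' Hbb] _ Hab Hab'.
apply: te_compI; try exact: te_compI.
rewrite !(tibd_comp_low _ p); apply: te_trans Hbb _.
apply: te_trans (te_sym (te_ibd_ibd true true p q r Hb')) _.
apply: te_trans (te_ibd true p (te_sym Hab')) _.
exact: te_ibd_ibd.
Qed.

Lemma te_assoc_wfr k n (p : lt_dim k n) (a b c : tm X n) :
  teq (tcomp p (tcomp p a b) c) (tcomp p (tcomp p a b) c) ->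
  teq (tcomp p a (tcomp p b c)) (tcomp p a (tcomp p b c)).
Proof.
case/te_comp_inv=> /te_comp_inv [Ha Hb Hab] Hc; rewrite tibd_comp => Hbc.
by apply: te_compI => //; [apply: te_compI | rewrite tibd_comp].
Qed.

Lemma te_assoc_wfl k n (p : lt_dim k n) (a b c : tm X n) :
  teq (tcomp p a (tcomp p b c)) (tcomp p a (tcomp p b c)) ->
  teq (tcomp p (tcomp p a b) c) (tcomp p (tcomp p a b) c).
Proof.
case/te_comp_inv=> Ha /te_comp_inv [Hb Hc Hbc]; rewrite tibd_comp => Hab.
by apply: te_compI => //; [apply: te_compI | rewrite tibd_comp].
Qed.

Lemma te_idcomp_wfr k n (p : lt_dim k n) (a b : tm X n) :
  teq (tid (tcomp p a b)) (tid (tcomp p a b)) ->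
  teq (tcomp (ltd_up p) (tid a) (tid b)) (tcomp (ltd_up p) (tid a) (tid b)).
Proof.
move/te_id_inv/te_comp_inv=> [Ha Hb Hab].
by apply: te_compI => //; apply: te_id.
Qed.

Lemma te_idcomp_wfl k n (p : lt_dim k n) (a b : tm X n) :
  teq (tcomp (ltd_up p) (tid a) (tid b)) (tcomp (ltd_up p) (tid a) (tid b)) ->
  teq (tid (tcomp p a b)) (tid (tcomp p a b)).
Proof.
case/te_comp_inv=> /te_id_inv Ha /te_id_inv Hb Hab.
by apply: te_id; apply: te_compI.
Qed.

(** The interpretation of terms in [ptree_ocat] that extends [lin_gmap]. It is defined on raw terms
    without [option], as [pcomp] is total, and agrees with [interp] wherever the latter is
    defined. *)
Fixpoint term_tree n (t : tm X n) : ptree (label X) n :=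
  match t in tm _ m return ptree (label X) m with
  | tgen _ x => lin x
  | tid n a => res false n n.+1 (term_tree a)
  | tcomp k n _ a b => pcomp k n (term_tree a) (term_tree b)
  end.

Lemma interp_term_tree n (t : tm X n) c : interp (lin_gmap X) t = Some c -> term_tree t = c.
Proof.
elim: t c => {n} [n x|n a IH|k n p a IHa b IHb] c.
- by case.
- rewrite /=; case E : (interp _ a) => [u|] //= [<-].
  by rewrite (IH _ E).
by case/interp_comp=> u [v [H [Eu Ev ->]]]; rewrite /= (IHa _ Eu) (IHb _ Ev).
Qed.

Lemma term_tree_teq n (t u : tm X n) : teq t u -> term_tree t = term_tree u.
Proof.
move/(interp_sound (lin_gmap X)) => [c [Ht Hu]].
by rewrite (interp_term_tree Ht) (interp_term_tree Hu).
Qed.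

Lemma term_tree_ibd d k n (p : lt_dim k n) (t : tm X n) : teq t t ->
  term_tree (tibd d p t) = res d n k (term_tree t).
Proof.
move/(interp_sound (lin_gmap X)) => [c [Ht _]]; rewrite (interp_term_tree Ht).
case: d; first by rewrite (interp_term_tree (interp_itgt p Ht)) itgt_res.
by rewrite (interp_term_tree (interp_isrc p Ht)) isrc_res.
Qed.

Lemma term_tree_match k n (p : lt_dim k n) (a b : tm X n) :
  teq (tcomp p a b) (tcomp p a b) -> pmatch k (term_tree a) (term_tree b).
Proof.
case/te_comp_inv=> Ha Hb /term_tree_teq; by rewrite !term_tree_ibd.
Qed.

End TermBoundaries.

(** * Lifting of equalities along a globular map *)

Section Lifting.
Context (X Y : globset) (f : gmap X Y).

Fixpoint tmap n (t : tm X n) : tm Y n :=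
  match t in tm _ m return tm Y m with
  | tgen _ x => tgen (f _ x)
  | tid _ a => tid (tmap a)
  | tcomp _ _ p a b => tcomp p (tmap a) (tmap b)
  end.

Lemma tmap_bd d n (t : tm X n) : tmap (tbd d t) = tbd d (tmap t).
Proof.
elim: t => [[|m] x|m a IH|k m p a IHa b IHb] //=.
  by case: d; rewrite ?gfun_src ?gfun_tgt.
by case: p a b IHa IHb => [|i q] a b /= <- <- //; case: d.
Qed.

Lemma tmap_ibd d k n (p : lt_dim k n) (t : tm X n) :
  tmap (tibd d p t) = tibd d p (tmap t).
Proof. by elim: p t => [|m q IH] t /=; [exact: (tmap_bd d t) | rewrite IH (tmap_bd d t)]. Qed.

Lemma tmap_iid k n (p : lt_dim k n) (t : tm X k) :
  tmap (tiid p t) = tiid p (tmap t).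
Proof. by elim: p => [|m q IH] //=; rewrite IH. Qed.

Lemma term_tree_tmap n (t : tm X n) : term_tree (tmap t) = pmap (label_map f) n (term_tree t).
Proof.
elim: t => {n} [n x|n a IH|k n p a IHa b IHb] /=.
- by rewrite pmap_lin.
- by rewrite IH; apply/esym/(@pmap_res _ _ (label_map f) false n n.+1).
by rewrite pmap_pcomp IHa IHb.
Qed.

(** All inversions of [tmap] as one dependent match, so that no equation between terms of different
    indices has to be destructed. *)
Lemma tmap_view n (t : tm X n) :
  match tmap t in tm _ m return tm X m -> Prop with
  | tgen _ y => fun t => exists2 x, t = tgen x & f _ x = y
  | tid _ a => fun t => exists2 t0, t = tid t0 & tmap t0 = a
  | tcomp _ _ p a b => fun t =>
      exists t1 t2, [/\ t = tcomp p t1 t2, tmap t1 = a & tmap t2 = b]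
  end t.
Proof. by case: t => [m x|m a|k m p a b] /=; [exists x | exists a | exists a, b]. Qed.

Lemma tmap_gen_inv n (t : tm X n) y : tmap t = tgen y ->
  exists2 x, t = tgen x & f n x = y.
Proof. by move=> E; have := tmap_view t; rewrite E. Qed.

Lemma tmap_id_inv n (t : tm X n.+1) a : tmap t = tid a ->
  exists2 t0, t = tid t0 & tmap t0 = a.
Proof. by move=> E; have := tmap_view t; rewrite E. Qed.

Lemma tmap_comp_inv k n (p : lt_dim k n) (t : tm X n) a b : tmap t = tcomp p a b ->
  exists t1 t2, [/\ t = tcomp p t1 t2, tmap t1 = a & tmap t2 = b].
Proof. by move=> E; have := tmap_view t; rewrite E. Qed.

Lemma tmap_iid_inv k n (p : lt_dim k n) (t : tm X n) a : tmap t = tiid p a ->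
  exists2 t0, t = tiid p t0 & tmap t0 = a.
Proof.
elim: p t => [|m q IH] t /= /tmap_id_inv [t0 -> // E]; first by exists t0.
by have [t1 -> <-] := IH _ E; exists t1.
Qed.

(** The common image fixes the syntax of both terms and the shapes of all factors, so [pcomp_inj]
    splits the trees along the composites down to the generators, where [lin] is injective. *)
Lemma tmap_term_tree_inj n (t u : tm X n) : teq t t -> teq u u ->
  tmap t = tmap u -> term_tree t = term_tree u -> t = u.
Proof.
elim: t u => {n} [n x|n a IH|k n p a IHa b IHb] u Ht Hu /= /esym.
- by case/tmap_gen_inv=> x' -> _ /= /lin_inj ->.
- case/tmap_id_inv=> u0 Eu Em /= E; rewrite {}Eu in Hu E *.
  rewrite (IH u0) //; try exact: te_id_inv.
  (* The source of an identity is the original cell, hence taking identities of trees is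
     injective. *)
  have K (x : ptree _ n) : res false n.+1 n (res false n n.+1 x) = x by rewrite res_res // res_id.
  by rewrite -(K _ (term_tree a)) -(K _ (term_tree u0)); apply: congr1.
case/tmap_comp_inv=> u1 [u2 [Eu Em1 Em2]] /= E; rewrite {}Eu in Hu E *.
have [Ha Hb _] := te_comp_inv Ht; have [Hu1 Hu2 _] := te_comp_inv Hu.
have [] := @pcomp_inj _ _ (label_map f) _ _ _ _ _ _ (ltd_ltn p) (term_tree_match Ht) (term_tree_match Hu) _ _ E;
  rewrite -?term_tree_tmap ?Em1 ?Em2 // => E1 E2.
by rewrite (IHa u1) // (IHb u2).
Qed.

Definition lifts_teq n (s s' : tm Y n) := forall t, tmap t = s -> teq t t ->
  exists2 t', tmap t' = s' & teq t t'.

Definition tree_detects_teq n := forall t u : tm X n, teq t t -> teq u u ->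
  teq (tmap t) (tmap u) -> term_tree t = term_tree u -> teq t u.

(** Both directions are proved at once because of [ce_sym]. Uniqueness in lower dimensions is called
    on only for interchange, read from right to left. *)
Lemma ceq_lifts N : (forall k, k < N -> tree_detects_teq k) ->
  forall n (s s' : tm Y n), ceq s s' -> n <= N -> lifts_teq s s' /\ lifts_teq s' s.
Proof.
move=> det n s s'; elim=> {n s s'}.
- by move=> n a b _ IH Hn; have [] := IH Hn.
- move=> n a b c _ IH _ IH' Hn; have [L1 R1] := IH Hn; have [L2 R2] := IH' Hn.
  split=> t Et Ht.
    have [t1 E1 H1] := L1 t Et Ht; have [t2 E2 H2] := L2 t1 E1 (teq_reflR H1).
    by exists t2 => //; apply: te_trans H2.
  have [t1 E1 H1] := R2 t Et Ht; have [t2 E2 H2] := R1 t1 E1 (teq_reflR H1).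
  by exists t2 => //; apply: te_trans H2.
- by move=> n x _; split=> t Et Ht; exists t.
- move=> n a a' _ IH Hn; have [L R] := IH (ltnW Hn).
  split=> _ /tmap_id_inv [t -> Et] /te_id_inv Ht.
    by have [t' <- H] := L t Et Ht; exists (tid t') => //; apply: te_id.
  by have [t' <- H] := R t Et Ht; exists (tid t') => //; apply: te_id.
- move=> k n p a a' b b' _ IHa _ IHb _ Hn.
  have [La Ra] := IHa Hn; have [Lb Rb] := IHb Hn.
  split=> _ /tmap_comp_inv [t1 [t2 [-> E1 E2]]] /te_comp_inv [H1 H2 H].
    have [u1 <- Hu1] := La t1 E1 H1; have [u2 <- Hu2] := Lb t2 E2 H2.
    by exists (tcomp p u1 u2) => //; apply: te_comp.
  have [u1 <- Hu1] := Ra t1 E1 H1; have [u2 <- Hu2] := Rb t2 E2 H2.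
  by exists (tcomp p u1 u2) => //; apply: te_comp.
- move=> k n p a b c _ _ _; split.
    move=> _ /tmap_comp_inv [_ [t3 [-> /tmap_comp_inv [t1 [t2 [-> <- <-]]] <-]]] Ht.
    exists (tcomp p t1 (tcomp p t2 t3)) => //.
    by apply: te_assoc => //; apply: te_assoc_wfr.
  move=> _ /tmap_comp_inv [t1 [_ [-> <- /tmap_comp_inv [t2 [t3 [-> <- <-]]]]]] Ht.
  exists (tcomp p (tcomp p t1 t2) t3) => //.
  by apply/te_sym/te_assoc => //; apply: te_assoc_wfl.
- move=> k n p a _ _; split=> [_ /tmap_comp_inv [_ [t [-> /tmap_iid_inv [u -> _] <-]]] Ht|t <- Ht].
    have [Hu Ht0 ] := te_comp_inv Ht; rewrite tibd_tiid => H.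
    exists t => //; apply: te_trans (te_idlI p Ht0).
    by apply: te_comp; rewrite ?tibd_tiid //; apply: te_iid.
  exists (tcomp p (tiid p (tibd true p t)) t).
    by rewrite /= tmap_iid tmap_ibd.
  exact/te_sym/te_idlI.
- move=> k n p a _ _; split=> [_ /tmap_comp_inv [t [_ [-> <- /tmap_iid_inv [u -> _]]]] Ht|t <- Ht].
    have [Ht0 Hu] := te_comp_inv Ht; rewrite tibd_tiid => H.
    exists t => //; apply: te_trans (te_idrI p Ht0).
    by apply: te_comp; rewrite ?tibd_tiid //; apply/te_iid/te_sym.
  exists (tcomp p t (tiid p (tibd false p t))).
    by rewrite /= tmap_iid tmap_ibd.
  exact/te_sym/te_idrI.
- move=> k n p a b _ _; split.
    move=> _ /tmap_id_inv [_ -> /tmap_comp_inv [t1 [t2 [-> <- <-]]]] Ht.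
    exists (tcomp (ltd_up p) (tid t1) (tid t2)) => //.
    by apply: te_idcomp => //; apply: te_idcomp_wfr.
  move=> _ /tmap_comp_inv [_ [_ [-> /tmap_id_inv [t1 -> <-] /tmap_id_inv [t2 -> <-]]]] Ht.
  exists (tid (tcomp p t1 t2)) => //.
  by apply/te_sym/te_idcomp => //; apply: te_idcomp_wfl.
move=> j k n p q r a b a' b' Hl _ Hn; split.
  move=> _ /tmap_comp_inv [_ [_ [-> /tmap_comp_inv [t1 [t2 [-> <- <-]]]
    /tmap_comp_inv [t3 [t4 [-> <- <-]]]]]] Ht.
  exists (tcomp q (tcomp r t1 t3) (tcomp r t2 t4)) => //.
  by apply: (te_inter p) => //; apply: (te_inter_wf p).
move=> _ /tmap_comp_inv [_ [_ [-> /tmap_comp_inv [t1 [t3 [-> E1 E3]]]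
  /tmap_comp_inv [t2 [t4 [-> E2 E4]]]]]] Ht; subst a b a' b'.
exists (tcomp r (tcomp q t1 t2) (tcomp q t3 t4)) => //.
(* Composability of the lifted cells is an instance of the uniqueness of
   decompositions in the lower dimension [k]. *)
have [Hl1 Hl2 _] := te_comp_inv Hl.
have [_ _ C12] := te_comp_inv Hl1; have [_ _ C34] := te_comp_inv Hl2.
have [H13 H24 H] := te_comp_inv Ht; rewrite !(tibd_comp_high _ p) in H.
have [T1 T3 _] := te_comp_inv H13; have [T2 T4 _] := te_comp_inv H24.
have [] := @pcomp_inj _ _ (label_map f) _ _ _ _ _ _ (ltd_ltn p) (term_tree_match (teq_reflL H))
  (term_tree_match (teq_reflR H)) _ _ (term_tree_teq H);
  rewrite -?term_tree_tmap ?tmap_ibd; try exact: term_tree_teq.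
move=> E12 E34.
have ltkN : k < N by apply: leq_trans Hn; apply: ltd_ltn q.
have C1 : teq (tibd false q t1) (tibd true q t2).
  by apply: det => //; rewrite ?tmap_ibd //; apply: te_ibd.
have C2 : teq (tibd false q t3) (tibd true q t4).
  by apply: det => //; rewrite ?tmap_ibd //; apply: te_ibd.
by apply/te_sym/(te_inter p) => //; apply: (te_inter_inv p).
Qed.

(** Lifting the equality of images replaces [u] by an equal term [t'] with the same image as [t].
    The trees of [t] and [t'] agree too, so the two are syntactically the same term. *)
Lemma tree_detects_teq_all n : tree_detects_teq n.
Proof.
have [N] := ubnP n; elim: N n => // N IH n Hn t u Ht Hu Em Ei.
have [_ L] := ceq_lifts IH (teq_ceq Em) Hn.
have [t' Et' H] := L u erefl Hu.
have -> : t = t' by apply: tmap_term_tree_inj (teq_reflR H) _ _ => //; rewrite Ei; apply: term_tree_teq.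
exact: te_sym.
Qed.

Lemma teq_lifts n (s s' : tm Y n) : teq s s' -> lifts_teq s s'.
Proof.
by move=> H; have [] := ceq_lifts (fun k _ => @tree_detects_teq_all k) (teq_ceq H) (leqnn n).
Qed.

End Lifting.

(** * Unique lifting in free strict omega-categories *)

Lemma gmapE (A B : globset) (f g : gmap A B) n (x : A n) : f = g -> f n x = g n x.
Proof. by move=> ->. Qed.

Section Denotation.
Context (F : free_ocats).

Definition to_terms X : ofunctor (F X) (fcat X) := free_ext (F X) (fgen X).

Definition of_terms X : ofunctor (fcat X) (F X) := ext (eta F X).

Lemma to_termsK X n (a : F X n) : of_terms X n (to_terms X n a) = a.
Proof.
have /(gmapE a) // : (ofcomp (of_terms X) (to_terms X) : gmap (F X) (F X)) = ofid (F X).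
apply: free_ext_uniq; apply: gmap_ext => k x /=.
have -> : to_terms X k (eta F X k x) = fgen X k x.
  exact: (gmapE x (free_ext_gen (F X) (fgen X))).
exact: (gmapE x (ext_gen (eta F X))).
Qed.

Lemma of_termsK X n (a : fcat X n) : to_terms X n (of_terms X n a) = a.
Proof.
have /(gmapE a) // : (ofcomp (to_terms X) (of_terms X) : gmap (fcat X) (fcat X)) = ofid (fcat X).
apply: ext_uniq; apply: gmap_ext => k x.
have E : of_terms X k (fgen X k x) = eta F X k x.
  exact: (gmapE x (ext_gen (eta F X))).
rewrite [LHS](_ : _ = to_terms X k (of_terms X k (fgen X k x))) // E.
exact: (gmapE x (free_ext_gen (F X) (fgen X))).
Qed.

(** A relation between cells for an arbitrary choice [F] and terms, which avoids fixing
    representatives. *)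
Definition denotes X n (a : T F X n) (t : tm X n) : Prop :=
  exists H : teq t t, to_terms X n a = cls H.

Section OneGlobset.
Context (X : globset).

Lemma denotes_ex n (a : T F X n) : exists t, denotes a t.
Proof. by have [t [H E]] := clsP (to_terms X n a); exists t, H. Qed.

Lemma denotes_of n (t : tm X n) : teq t t -> exists a, denotes a t.
Proof. by move=> H; exists (of_terms X n (cls H : fcat X n)), H; rewrite of_termsK. Qed.

Lemma denotes_wf n (a : T F X n) t : denotes a t -> teq t t.
Proof. by case. Qed.

Lemma denotes_inj n (a b : T F X n) t u : denotes a t -> denotes b u -> teq t u -> a = b.
Proof.
move=> [Ht Ea] [Hu Eb] /(cls_eq Ht Hu) E.
by rewrite -(to_termsK a) -(to_termsK b) Ea Eb E.
Qed.

Lemma denotes_teq n (a : T F X n) t u : denotes a t -> denotes a u -> teq t u.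
Proof. by case=> [Ht Ea] [Hu]; rewrite Ea => /cls_inj. Qed.

Lemma denotes_gen n (x : X n) : denotes (eta F X n x) (tgen x).
Proof.
exists (te_gen x); exact: (gmapE x (free_ext_gen (F X) (fgen X))).
Qed.

Lemma denotes_id n (a : T F X n) t : denotes a t -> denotes (oid a : T F X n.+1) (tid t).
Proof.
case=> Ht Ea; exists (te_id Ht).
by rewrite (of_id (to_terms X)) Ea; apply: fid_cls.
Qed.

Lemma denotes_isrc k n (p : lt_dim k n) (a : T F X n) t :
  denotes a t -> denotes (isrc p a) (tibd false p t).
Proof.
by case=> Ht Ea; exists (te_ibd false p Ht); rewrite gfun_isrc Ea isrc_cls.
Qed.

Lemma denotes_itgt k n (p : lt_dim k n) (a : T F X n) t :
  denotes a t -> denotes (itgt p a) (tibd true p t).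
Proof.
by case=> Ht Ea; exists (te_ibd true p Ht); rewrite gfun_itgt Ea itgt_cls.
Qed.

Lemma denotes_match k n (p : lt_dim k n) (a b : T F X n) t u : denotes a t -> denotes b u ->
  isrc p a = itgt p b <-> teq (tibd false p t) (tibd true p u).
Proof.
move=> /(denotes_isrc p) Ha /(denotes_itgt p) Hb; split=> [E|]; last exact: denotes_inj.
by apply: denotes_teq Ha _; rewrite E.
Qed.

Lemma denotes_comp k n (p : lt_dim k n) (a b : F X n) t u H :
  denotes a t -> denotes b u -> denotes (ocomp p a b H : T F X n) (tcomp p t u).
Proof.
move=> Ha Hb; have [Ht Ea] := Ha; have [Hu Eb] := Hb.
have /(denotes_match p Ha Hb) Htu := H.
exists (te_comp Ht Hu Htu).
have H' : isrc p (to_terms X n a) = itgt p (to_terms X n b).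
  by rewrite -gfun_isrc -gfun_itgt H.
rewrite (of_comp H H').
have H2 : isrc p (cls Ht : fcat X n) = itgt p (cls Hu : fcat X n) by rewrite -Ea -Eb.
rewrite [LHS](fcompE H' H2 Ea Eb) fcomp_cls.
by apply: cls_eq; apply: te_comp.
Qed.

Lemma T_cell_ind (Q : forall n, T F X n -> Prop) :
  (forall n x, Q n (eta F X n x)) ->
  (forall n (a : F X n), Q n a -> Q n.+1 (oid a)) ->
  (forall k n p (a b : F X n) H, Q n a -> Q n b -> Q n (@ocomp (F X) k n p a b H)) ->
  forall n a, Q n a.
Proof.
move=> Qgen Qid Qcomp n a; have [t] := denotes_ex a.
elim: t a => {n} [n x|n t IH|k n p t IHt u IHu] a Da.
- by rewrite (denotes_inj Da (denotes_gen x) (te_gen x)).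
- have [a0 D0] := denotes_of (te_id_inv (denotes_wf Da)).
  by rewrite (denotes_inj Da (denotes_id D0) (denotes_wf Da)); apply/Qid/IH.
have [Ht Hu Htu] := te_comp_inv (denotes_wf Da).
have [b Db] := denotes_of Ht; have [c Dc] := denotes_of Hu.
have /(denotes_match p Db Dc) H := Htu.
by rewrite (denotes_inj Da (denotes_comp H Db Dc) (denotes_wf Da)); apply: Qcomp; [apply: IHt | apply: IHu].
Qed.

Lemma eta_inj n (x y : X n) : eta F X n x = eta F X n y -> x = y.
Proof.
move=> E; have := denotes_gen y; rewrite -E => /(denotes_teq (denotes_gen x)) /term_tree_teq.
exact: lin_inj.
Qed.

End OneGlobset.

Section UniqueLifting.
Context (X Y : globset) (f : gmap X Y).

Lemma denotes_map n (a : T F X n) t : denotes a t -> denotes (Tmap F f n a) (tmap f t).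
Proof.
elim: t a => {n} [n x|n t IH|k n p t IHt u IHu] a Da.
- rewrite (denotes_inj Da (denotes_gen x) (te_gen x)).
  have -> : Tmap F f n (eta F X n x) = eta F Y n (f n x) by exact: (gmapE x (eta_nat F f)).
  exact: denotes_gen.
- have [a0 D0] := denotes_of (te_id_inv (denotes_wf Da)).
  rewrite (denotes_inj Da (denotes_id D0) (denotes_wf Da)) (of_id (Tfun F f)).
  by apply: denotes_id; apply: IH.
have [Ht Hu Htu] := te_comp_inv (denotes_wf Da).
have [b Db] := denotes_of Ht; have [c Dc] := denotes_of Hu.
have /(denotes_match p Db Dc) H := Htu.
rewrite (denotes_inj Da (denotes_comp H Db Dc) (denotes_wf Da)).
have H' : isrc p (Tfun F f n b) = itgt p (Tfun F f n c).
  by rewrite -gfun_isrc -gfun_itgt H.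
by rewrite (of_comp H H'); apply: denotes_comp; [apply: IHt | apply: IHu].
Qed.

(** Together with [eta_inj], this makes the naturality square of [eta] at [f] a pullback. *)
Lemma lift_gen n (a : T F X n) y : Tmap F f n a = eta F Y n y ->
  exists2 x, a = eta F X n x & f n x = y.
Proof.
have [t Da] := denotes_ex a => E.
have := denotes_gen y; rewrite -E => /(denotes_teq (denotes_map Da)) /(@teq_lifts _ _ f) L.
have [t' /tmap_gen_inv [x -> Ex] H] := L t erefl (denotes_wf Da).
by exists x => //; apply: denotes_inj Da (denotes_gen x) H.
Qed.

Lemma lift_id n (a : T F X n.+1) (c : F Y n) : Tmap F f n.+1 a = oid c ->
  exists2 a' : F X n, a = oid a' & Tmap F f n a' = c.
Proof.
have [t Da] := denotes_ex a; have [s Dc] := denotes_ex c => E.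
have := denotes_id Dc; rewrite -E => /(denotes_teq (denotes_map Da)) /(@teq_lifts _ _ f) L.
have [t' /tmap_id_inv [t0 -> Et0] H] := L t erefl (denotes_wf Da).
have [a0 D0] := denotes_of (te_id_inv (teq_reflR H)).
exists a0; first exact: denotes_inj Da (denotes_id D0) H.
by apply: (denotes_inj (denotes_map D0) Dc); rewrite Et0; apply: denotes_wf Dc.
Qed.

(** With [lift_id] and [lift_comp_uniq] it says that [Tmap F f] is a discrete Conduché functor:
    decompositions of the image lift uniquely. *)
Lemma lift_comp k n (p : lt_dim k n) (a : T F X n) (c d : F Y n) H :
  Tmap F f n a = ocomp p c d H ->
  exists (a1 a2 : F X n) H', [/\ a = ocomp p a1 a2 H', Tmap F f n a1 = c & Tmap F f n a2 = d].
Proof.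
have [t Da] := denotes_ex a; have [s Dc] := denotes_ex c; have [s' Dd] := denotes_ex d => E.
have := denotes_comp H Dc Dd; rewrite -E => /(denotes_teq (denotes_map Da)) /(@teq_lifts _ _ f) L.
have [t' /tmap_comp_inv [t1 [t2 [-> E1 E2]]] K] := L t erefl (denotes_wf Da).
have [H1 H2 H12] := te_comp_inv (teq_reflR K).
have [a1 D1] := denotes_of H1; have [a2 D2] := denotes_of H2.
have /(denotes_match p D1 D2) H' := H12.
exists a1, a2, H'; split; first exact: denotes_inj Da (denotes_comp H' D1 D2) K.
  by apply: (denotes_inj (denotes_map D1) Dc); rewrite E1; apply: denotes_wf Dc.
by apply: (denotes_inj (denotes_map D2) Dd); rewrite E2; apply: denotes_wf Dd.
Qed.

Lemma lift_comp_uniq k n (p : lt_dim k n) (a b a' b' : F X n) H H' :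
  ocomp p a b H = ocomp p a' b' H' ->
  Tmap F f n a = Tmap F f n a' -> Tmap F f n b = Tmap F f n b' -> a = a' /\ b = b'.
Proof.
have [t Dt] := denotes_ex a; have [u Du] := denotes_ex b.
have [t' Dt'] := denotes_ex a'; have [u' Du'] := denotes_ex b'.
move=> E Ea Eb.
have Hab : teq (tcomp p t u) (tcomp p t' u').
  by apply: denotes_teq (denotes_comp H Dt Du) _; rewrite E; apply: denotes_comp.
have Ht : teq (tmap f t) (tmap f t').
  by apply: denotes_teq (denotes_map Dt) _; rewrite Ea; apply: denotes_map.
have Hu : teq (tmap f u) (tmap f u').
  by apply: denotes_teq (denotes_map Du) _; rewrite Eb; apply: denotes_map.
have [] := @pcomp_inj _ _ (label_map f) _ _ _ _ _ _ (ltd_ltn p)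
  (term_tree_match (teq_reflL Hab)) (term_tree_match (teq_reflR Hab)) _ _ (term_tree_teq Hab);
  rewrite -?term_tree_tmap; try exact: term_tree_teq.
move=> Et Eu; split.
  by apply: (denotes_inj Dt Dt'); apply: (tree_detects_teq_all (f := f)) => //; apply: denotes_wf; eassumption.
by apply: (denotes_inj Du Du'); apply: (tree_detects_teq_all (f := f)) => //; apply: denotes_wf; eassumption.
Qed.

End UniqueLifting.
End Denotation.

(** * The monoidal closed structure on collections *)

(** Preimages chosen cell by cell commute with sources and targets automatically, because [i] is
    injective. *)
Lemma gmap_factor (A B C : globset) (i : gmap B C) (g : gmap A C) :
  (forall n, injective (i n)) -> (forall n a, exists b, i n b = g n a) ->
  exists h : gmap A B, i \og h = g.
Proof.
move=> inj ex.
pose h n a := sval (constructive_indefinite_description _ (ex n a)).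
have hE n a : i n (h n a) = g n a.
  by rewrite /h; case: constructive_indefinite_description.
have hs n a : h n (src a) = src (h n.+1 a) by apply: inj; rewrite gfun_src !hE gfun_src.
have ht n a : h n (tgt a) = tgt (h n.+1 a) by apply: inj; rewrite gfun_tgt !hE gfun_tgt.
by exists (GMap hs ht); apply: gmap_ext => n a; apply: hE.
Qed.

(** * Invertibility of the associator and existence of the left unitor *)

Section Cartesian.
Context (F : free_ocats).

Section PasteTensor.
Context (y z : collection F).

(** Together with [Tmap F (tens1 y z)] it exhibits [T F (tensor y z)] as the pullback of [T F y] and
    [T F z] over [T F terminal], as the next three lemmas show. As an [ofunctor] it can be computed
    on identities and composites. *)
Definition flat2 : ofunctor (F (tensor y z)) (F z) :=
  ofcomp (mufun F z) (Tfun F (tens2 y z)).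

Lemma flat2_eta n (c : tensor y z n) : flat2 n (eta F _ n c) = tens2 y z n c.
Proof.
rewrite [LHS](_ : _ = mu F z n (Tmap F (tens2 y z) n (eta F _ n c))) //.
rewrite (gmapE c (eta_nat F (tens2 y z)) : Tmap F (tens2 y z) n (eta F _ n c) = _).
exact: (gmapE _ (mu_eta F z)).
Qed.

Lemma bang_flat2 n (u : T F (tensor y z) n) :
  Tmap F (bang z) n (flat2 n u) =
  mu F terminal n (Tmap F (proj y) n (Tmap F (tens1 y z) n u)).
Proof.
rewrite -(gmapE _ (mu_nat F (bang z)) : _ = Tmap F (bang z) n (mu F z n _)) /=.
congr (mu F terminal n _).
rewrite -(gmapE u (Tmap_comp F (Tmap F (bang z)) (tens2 y z)) : _ = Tmap F _ n (Tmap F _ n u)).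
by rewrite -tens_square Tmap_comp.
Qed.

(** Induction on the common image [w] in [T F y]: both cells decompose as [w] does. By [bang_flat2]
    their flattened factors have the same images under [Tmap F (bang z)], so [lift_comp_uniq]
    separates them. *)
Lemma T_tensor_inj n (u u' : T F (tensor y z) n) :
  Tmap F (tens1 y z) n u = Tmap F (tens1 y z) n u' -> flat2 n u = flat2 n u' -> u = u'.
Proof.
move Ew : (Tmap F (tens1 y z) n u) => w /esym Ew'.
elim/T_cell_ind: n / w u u' Ew Ew' => [n y0|n w IH|k n p w1 w2 H IH1 IH2] u u'.
- move=> /lift_gen [c -> Ec] /lift_gen [c' -> Ec']; rewrite !flat2_eta => E.
  by congr (eta F _ n _); apply: pb_cell_ext => //; rewrite -[LHS]/(tens1 y z n c) Ec.
- move=> /lift_id [a -> Ea] /lift_id [a' -> Ea'].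
  rewrite !(of_id flat2) => /(congr1 src); rewrite !oid_src => E.
  by rewrite (IH a a').
move=> /lift_comp [a1 [a2 [Ha [-> Ea1 Ea2]]]] /lift_comp [b1 [b2 [Hb [-> Eb1 Eb2]]]].
have Ha' : isrc p (flat2 n a1) = itgt p (flat2 n a2) by rewrite -gfun_isrc -gfun_itgt Ha.
have Hb' : isrc p (flat2 n b1) = itgt p (flat2 n b2) by rewrite -gfun_isrc -gfun_itgt Hb.
rewrite (of_comp Ha Ha') (of_comp Hb Hb') => /(@lift_comp_uniq _ _ _ (bang z)) E.
have [] := E; rewrite ?bang_flat2 ?Ea1 ?Ea2 ?Eb1 ?Eb2 // => E1 E2.
have {}E1 := IH1 _ _ Ea1 Eb1 E1; have {}E2 := IH2 _ _ Ea2 Eb2 E2.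
by subst b1 b2; rewrite (proof_irrelevance _ Ha Hb).
Qed.

(** Induction on [w], whose decomposition is transferred to [v] by lifting along [Tmap F (bang z)].
    On a generator the hypothesis is the condition defining a cell of [tensor y z]. *)
Lemma T_tensor_surj n (w : T F y n) (v : T F z n) :
  mu F terminal n (Tmap F (proj y) n w) = Tmap F (bang z) n v ->
  exists2 u, Tmap F (tens1 y z) n u = w & flat2 n u = v.
Proof.
elim/T_cell_ind: n / w v => [n y0|n w IH|k n p w1 w2 H IH1 IH2] v.
- rewrite (gmapE y0 (eta_nat F (proj y)) : Tmap F _ n (eta F _ n y0) = _).
  rewrite (gmapE _ (mu_eta F terminal) : mu F _ n (eta F _ n _) = _) => E.
  exists (eta F _ n (exist _ (y0, v) E : tensor y z n)); last by rewrite flat2_eta.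
  exact: (gmapE _ (eta_nat F (tens1 y z))).
- rewrite (of_id (Tfun F (proj y))) (of_id (mufun F terminal)) => /esym.
  case/lift_id=> v' -> /esym /IH [u <- <-].
  by exists (oid (u : F _ n)); [apply: (of_id (Tfun F _)) | apply: (of_id flat2)].
have H1 : isrc p (Tfun F (proj y) n w1) = itgt p (Tfun F (proj y) n w2).
  by rewrite -gfun_isrc -gfun_itgt H.
have H2 : isrc p (mufun F terminal n (Tfun F (proj y) n w1)) =
    itgt p (mufun F terminal n (Tfun F (proj y) n w2)).
  by rewrite -gfun_isrc -gfun_itgt H1.
rewrite (of_comp H H1) (of_comp H1 H2) => /esym.
case/lift_comp=> v1 [v2 [Hv [-> /esym E1 /esym E2]]].
have [u1 T1 G1] := IH1 _ E1; have [u2 T2 G2] := IH2 _ E2.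
(* The pieces found by induction are composable because their boundaries agree in both
   components. *)
have Hu : isrc p (u1 : F (tensor y z) n) = itgt p u2.
  by apply: T_tensor_inj; rewrite !gfun_isrc !gfun_itgt ?T1 ?T2 ?G1 ?G2.
exists (ocomp p u1 u2 Hu).
  have H' : isrc p (Tfun F (tens1 y z) n u1) = itgt p (Tfun F (tens1 y z) n u2).
    by rewrite -gfun_isrc -gfun_itgt Hu.
  rewrite [LHS](of_comp Hu H'); move: H'; rewrite -/(Tmap F (tens1 y z)) T1 T2 => H'.
  by rewrite (proof_irrelevance _ H' H).
have H' : isrc p (flat2 n u1) = itgt p (flat2 n u2).
  by rewrite -gfun_isrc -gfun_itgt Hu.
rewrite [LHS](of_comp Hu H'); move: H'; rewrite G1 G2 => H'.
by rewrite (proof_irrelevance _ H' Hv).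
Qed.

End PasteTensor.

Lemma associator_iso (x y z : collection F) :
  exists a' : slice_hom (tensor (tensor x y) z) (tensor x (tensor y z)),
    associator x y z \os a' = slice_id _ /\ a' \os associator x y z = slice_id _.
Proof.
have inj n : injective (associator x y z n).
  move=> [[x1 u1] H1] [[x2 u2] H2] E.
  have E1 : x1 = x2 := congr1 (fun c => (sval (sval c).1).1) E.
  have E2 := congr1 (fun c => (sval (sval c).1).2) E.
  have E3 := congr1 (fun c => (sval c).2) E.
  by apply: pb_cell_ext => //; apply: (T_tensor_inj E2 E3).
have ex n (c : tensor (tensor x y) z n) : exists b, associator x y z n b = gid _ n c.
  case: c => [[[[x0 w] Hw] v] Hv].
  have [u E1 E2] := T_tensor_surj (Hv : mu F terminal n (Tmap F (proj y) n w) = _).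
  have Hu : proj x n x0 = Tmap F (bang (tensor y z)) n u.
    rewrite [LHS]Hw /= -E1.
    rewrite -(gmapE u (Tmap_comp F (bang y) (tens1 y z)) : _ = Tmap F _ n (Tmap F _ n u)).
    by rewrite (bang_uniq (bang y \og tens1 y z) (bang (tensor y z))).
  exists (exist _ (x0, u) Hu); apply: pb_cell_ext => //.
  exact: pb_cell_ext.
have [h Eh] := gmap_factor inj ex.
have Ec : proj (tensor x (tensor y z)) \og h = proj (tensor (tensor x y) z).
  by rewrite -(shcomm (associator x y z)) -gcompA Eh gcomp1.
exists (SliceHom Ec); split; apply: slice_hom_ext => //.
by apply: gmap_ext => n c; apply: inj; apply: (gmapE _ Eh).
Qed.

(** The pullback square says that the second projection becomes a generator in [T F terminal]; by
    [lift_gen] it is already a generator. *)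
Lemma left_unitor_ex (x : collection F) :
  exists l : slice_hom (tensor (unit_col F) x) x, is_left_unitor l.
Proof.
have ex n (c : tensor (unit_col F) x n) :
    exists b, eta F x n b = tens2 (unit_col F) x n c.
  have /esym := gmapE c (tens_square (unit_col F) x).
  by case/lift_gen=> b Eb _; exists b.
have [h Eh] := gmap_factor (fun n => @eta_inj F x n) ex.
have Ec : proj x \og h = proj (tensor (unit_col F) x).
  by rewrite tensor_proj -Eh !gcompA -[_ \og eta F x]gcompA eta_nat gcompA mu_eta g1comp.
by exists (SliceHom Ec).
Qed.

End Cartesian.

Lemma slice_compA Z (S R Q P : slice Z) (h : slice_hom Q P) (g : slice_hom R Q)
  (f : slice_hom S R) : h \os (g \os f) = h \os g \os f.
Proof. by apply: slice_hom_ext; apply: gcompA. Qed.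

Lemma slice_comp1 Z (S R : slice Z) (f : slice_hom S R) : f \os slice_id S = f.
Proof. by apply: slice_hom_ext; apply: gcomp1. Qed.

Lemma slice_1comp Z (S R : slice Z) (f : slice_hom S R) : slice_id R \os f = f.
Proof. by apply: slice_hom_ext; apply: g1comp. Qed.

(** * Naturality and coherence of the monoidal structure *)

Section Monoidal.
Context (F : free_ocats).
Implicit Types x y z w : collection F.

Lemma TmapM (X Y Z : globset) (g : gmap Y Z) (f : gmap X Y) n (u : T F X n) :
  Tmap F (g \og f) n u = Tmap F g n (Tmap F f n u).
Proof. exact: (gmapE u (Tmap_comp F g f)). Qed.

Lemma mu_natE (X Y : globset) (f : gmap X Y) n (u : T F (T F X) n) :
  mu F Y n (Tmap F (Tmap F f) n u) = Tmap F f n (mu F X n u).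
Proof. exact: (gmapE u (mu_nat F f)). Qed.

Lemma tensor_ext S x y (f g : slice_hom S (tensor x y)) :
  (forall n c, tens1 x y n (f n c) = tens1 x y n (g n c)) ->
  (forall n c, tens2 x y n (f n c) = tens2 x y n (g n c)) -> f = g.
Proof.
move=> E1 E2; apply: slice_hom_ext; apply: gmap_ext => n c.
by apply: pb_cell_ext; [apply: E1 | apply: E2].
Qed.

Lemma tensor_map_id x y : tensor_map (slice_id x) (slice_id y) = slice_id (tensor x y).
Proof. by apply: tensor_ext => n c //=; rewrite Tmap_id. Qed.

Lemma tensor_map_comp x x' x'' y y' y'' (f' : slice_hom x' x'') (f : slice_hom x x')
    (g' : slice_hom y' y'') (g : slice_hom y y') :
  tensor_map f' g' \os tensor_map f g = tensor_map (f' \os f) (g' \os g).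
Proof. by apply: tensor_ext => n c //=; rewrite TmapM. Qed.

Lemma associator_nat x x' y y' z z' (f : slice_hom x x') (g : slice_hom y y')
    (h : slice_hom z z') :
  tensor_map (tensor_map f g) h \os associator x y z =
  associator x' y' z' \os tensor_map f (tensor_map g h).
Proof.
apply: tensor_ext => n c /=.
  by apply: pb_cell_ext => //=; rewrite -!TmapM; congr (Tmap F _ n _); apply: gmap_ext.
rewrite -mu_natE -!TmapM; congr (mu F _ n (Tmap F _ n _)); exact: gmap_ext.
Qed.

Lemma pentagon x y z w :
  tensor_map (associator x y z) (slice_id w) \os associator x (tensor y z) w \os
    tensor_map (slice_id x) (associator y z w) =
  associator (tensor x y) z w \os associator x y (tensor z w).
Proof.
apply: tensor_ext => n c /=.
  apply: pb_cell_ext => /=.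
    by apply: pb_cell_ext => //=; rewrite -!TmapM; congr (Tmap F _ n _); apply: gmap_ext.
  rewrite -mu_natE -!TmapM; congr (mu F _ n (Tmap F _ n _)); exact: gmap_ext.
have E : tens2 (tensor y z) w \og assoc_gmap y z w =
    mu F w \og (Tmap F (tens2 z w) \og tens2 y (tensor z w)) by apply: gmap_ext.
rewrite Tmap_id /= -TmapM E !TmapM -[RHS](congr1 (mu F w n) (mu_natE (tens2 z w) _)).
exact: (gmapE _ (mu_mu F w)).
Qed.

Lemma left_unitor_nat x y (f : slice_hom x y) lx ly :
  is_left_unitor lx -> is_left_unitor ly ->
  f \os lx = ly \os tensor_map (slice_id (unit_col F)) f.
Proof.
move=> Lx Ly; apply: slice_hom_ext; apply: gmap_ext => n c.
apply: (@eta_inj F); rewrite [RHS](gmapE _ Ly).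
rewrite -[LHS](gmapE (lx n c) (eta_nat F f)).
exact: (congr1 (Tmap F f n) (gmapE c Lx)).
Qed.

(** The first components are compared after the injective [eta], using its naturality; for the
    second, flattening a generator returns its second projection. *)
Lemma left_unitor_tensor x y lx lxy :
  is_left_unitor lx -> is_left_unitor lxy ->
  tensor_map lx (slice_id y) \os associator (unit_col F) x y = lxy.
Proof.
move=> Lx Lxy; apply: tensor_ext => n e.
  apply: (@eta_inj F); rewrite [LHS](gmapE _ Lx) [LHS]/=.
  rewrite -[RHS](gmapE (lxy n e) (eta_nat F (tens1 x y))).
  exact: (congr1 (Tmap F (tens1 x y) n) (esym (gmapE e Lxy))).
rewrite /= Tmap_id -[RHS]flat2_eta.
exact: (congr1 (flat2 x y n) (esym (gmapE e Lxy))).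
Qed.

(** The triangle axiom, which comes down to the unit law [mu_Teta]. *)
Lemma right_unitor_tensor x y ly :
  is_left_unitor ly ->
  tensor_map (right_unitor x) (slice_id y) \os associator x (unit_col F) y =
  tensor_map (slice_id x) ly.
Proof.
move=> Ly; apply: tensor_ext => n e //=.
rewrite Tmap_id /= -Ly TmapM.
exact: (gmapE _ (mu_Teta F y)).
Qed.

End Monoidal.

(** * The adjunction between tensor and internal hom *)

Section Closed.
Context (F : free_ocats).
Context (b c : collection F).

Section Transposition.
Context (Z : collection F).

Let phi := Tmap F (bang b).
Let E := pbf (Tmap F (proj b)) (pbf (mu F terminal) c).

Lemma hom_untr_comm (k : slice_hom (pbf phi Z) E) :
  proj c \og (pb_fst _ _ \og (pb_fst _ _ \og k)) = proj (tensor Z b).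
Proof.
by rewrite !gcompA pb_square -(gcompA _ _ (pb_fst _ _)) pb_square gcompA -(gcompA _ _ k) (shcomm k).
Qed.

(** [pbf phi Z] and [tensor Z b] have the same underlying globular set. Forgetting both pullbacks in
    [E] is the adjunction of pullback with postcomposition, applied twice. *)
Definition hom_untr (k : slice_hom (pbf phi Z) E) : slice_hom (tensor Z b) c :=
  @SliceHom _ (tensor Z b) c _ (hom_untr_comm k).

Lemma hom_tr_sub1 (f : slice_hom (tensor Z b) c) :
  proj c \og f = mu F terminal \og (Tmap F (proj b) \og tens2 Z b).
Proof. by rewrite (shcomm f) gcompA. Qed.

Lemma hom_tr_sub2 (f : slice_hom (tensor Z b) c) :
  proj (pbf (mu F terminal) c) \og pb_pair (hom_tr_sub1 f) =
  Tmap F (proj b) \og tens2 Z b.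
Proof. exact: gmap_ext. Qed.

Lemma hom_tr_comm (f : slice_hom (tensor Z b) c) :
  proj E \og pb_pair (hom_tr_sub2 f) = proj (pbf phi Z).
Proof. exact: gmap_ext. Qed.

Definition hom_tr (f : slice_hom (tensor Z b) c) : slice_hom (pbf phi Z) E :=
  @SliceHom _ (pbf phi Z) E _ (hom_tr_comm f).

Lemma hom_trK f : hom_untr (hom_tr f) = f.
Proof. by apply: slice_hom_ext; apply: gmap_ext. Qed.

Lemma hom_untr_inj : injective hom_untr.
Proof.
move=> k k' /(congr1 (fun h : slice_hom _ _ => h : gmap _ _)) Ek.
apply: slice_hom_ext; apply: gmap_ext => n e.
have E2 : (sval (k n e)).2 = (sval (k' n e)).2.
  exact: etrans (slice_homP k e) (esym (slice_homP k' e)).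
apply: pb_cell_ext => //; apply: pb_cell_ext; first exact: (gmapE e Ek).
(* The remaining component, in [T F (T F terminal)], is determined by the one in [T F b]. *)
have := svalP (k n e); have := svalP (k' n e); rewrite /= E2 => <- //.
Qed.

End Transposition.

Definition hom_ev : slice_hom (tensor (hom_col b c) b) c := hom_untr (Pi_ev _ _).

Lemma hom_ev_map (Z : collection F) (g : slice_hom Z (hom_col b c)) :
  hom_ev \os tensor_map g (slice_id b) = hom_untr (Pi_ev _ _ \os pbf_map _ g).
Proof.
apply: slice_hom_ext; apply: gmap_ext => n e.
have Ee : tensor_map g (slice_id b) n e = pbf_map (Tmap F (bang b)) g n e.
  by apply: pb_cell_ext => //=; rewrite Tmap_id.
exact: (congr1 (hom_ev n) Ee).
Qed.

Lemma hom_ev_ex (Z : collection F) (f : slice_hom (tensor Z b) c) :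
  exists g : slice_hom Z (hom_col b c), hom_ev \os tensor_map g (slice_id b) = f.
Proof. by exists (Pi_tr (hom_tr f)); rewrite hom_ev_map Pi_tr_ev hom_trK. Qed.

Lemma hom_ev_inj (Z : collection F) (g g' : slice_hom Z (hom_col b c)) :
  hom_ev \os tensor_map g (slice_id b) = hom_ev \os tensor_map g' (slice_id b) -> g = g'.
Proof.
rewrite !hom_ev_map => /hom_untr_inj E.
by rewrite (Pi_tr_uniq E) -(Pi_tr_uniq erefl).
Qed.

End Closed.

(** * The monoid of endomorphisms *)

Section Endomorphisms.
Context (F : free_ocats).
Implicit Types S R V W : collection F.

Lemma associator_epi S R W V (g g' : slice_hom (tensor (tensor S R) W) V) :
  g \os associator S R W = g' \os associator S R W -> g = g'.
Proof.
have [a' [Ea _]] := associator_iso S R W => E.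
by rewrite -(slice_comp1 g) -(slice_comp1 g') -Ea !slice_compA E.
Qed.

Lemma tensor_associator_epi S R W U V
    (g g' : slice_hom (tensor S (tensor (tensor R W) U)) V) :
  g \os tensor_map (slice_id S) (associator R W U) =
  g' \os tensor_map (slice_id S) (associator R W U) -> g = g'.
Proof.
have [a' [Ea _]] := associator_iso R W U => E.
rewrite -(slice_comp1 g) -(slice_comp1 g') -tensor_map_id -Ea.
by rewrite -[slice_id S]slice_comp1 -tensor_map_comp !slice_compA E.
Qed.

Context (X : collection F).

Local Notation H := (Taut X).
Local Notation ev := (hom_ev X X).
Local Notation id1 := (slice_id _).

Theorem Taut_operad : inhabited (operad_on (Taut X)).
Proof.
(* The action property of [m], stated so that the inverse associator does not appear in it. *)
have [m Em] : exists m : slice_hom (tensor H H) H,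
    ev \os tensor_map m id1 \os associator H H X = ev \os tensor_map id1 ev.
  have [a' [_ Ea]] := associator_iso H H X.
  have [m Em] := hom_ev_ex (ev \os tensor_map id1 ev \os a').
  by exists m; rewrite Em -!slice_compA Ea slice_comp1.
have [lX LX] := left_unitor_ex X.
have [u Eu] := hom_ev_ex lX.
(* For generalised elements: the product of [f] and [g] acts as [g] followed by [f]. *)
have act S R (f : slice_hom S H) (g : slice_hom R H) :
    ev \os tensor_map (m \os tensor_map f g) id1 \os associator S R X =
    ev \os tensor_map f (ev \os tensor_map g id1).
  rewrite -[X in tensor_map _ X]slice_comp1 -tensor_map_comp slice_compA.
  rewrite -slice_compA associator_nat slice_compA Em.
  by rewrite -slice_compA tensor_map_comp slice_1comp.
have split S R (f : slice_hom S H) (g : slice_hom R X) :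
    ev \os tensor_map f g = ev \os tensor_map f id1 \os tensor_map id1 g.
  by rewrite -slice_compA tensor_map_comp slice_1comp slice_comp1.
have act1 S (f : slice_hom S H) :
    ev \os tensor_map (m \os tensor_map f id1) id1 \os associator S H X =
    ev \os tensor_map f ev.
  by rewrite act tensor_map_id slice_comp1.
exists; exists m u.
(* Both products are compared through their actions on [X]. Precomposing with two associators brings
   one side to the pentagon, after which both sides act three times in succession. *)
- apply: hom_ev_inj; apply: associator_epi; apply: tensor_associator_epi.
  rewrite act -slice_compA tensor_map_comp Em slice_comp1.
  rewrite -[X in tensor_map (_ \os associator _ _ _) X]slice_comp1 -tensor_map_comp.
  rewrite -!slice_compA (slice_compA (tensor_map (associator _ _ _) _)) pentagon.
  rewrite !slice_compA act1 [in RHS]split -(slice_compA (ev \os _)).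
  rewrite -(tensor_map_id H H) associator_nat slice_compA Em.
  by rewrite -slice_compA tensor_map_comp slice_1comp.
(* The unit law asks for the defining equation of a left unitor, so it is enough to identify the
   composite with the left unitor [lH], again through the action. *)
- have [lH LH] := left_unitor_ex H; have [lHX LHX] := left_unitor_ex (tensor H X).
  suff -> : m \os tensor_map u id1 = lH by [].
  apply: hom_ev_inj; apply: associator_epi.
  rewrite act1 split Eu -slice_compA (left_unitor_tensor LH LHX).
  by rewrite (left_unitor_nat _ LHX LX).
apply: hom_ev_inj; apply: associator_epi.
by rewrite act Eu -slice_compA (right_unitor_tensor _ LX).
Qed.
End Endomorphisms.

Theorem theorem8p1 (F : free_ocats) (X : collection F) :
  inhabited (operad_on (Taut X)).
Proof. exact: Taut_operad. Qed.
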